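(* Let $ABC$ be a triangle and $P$ a point not on the extended sides of $ABC$ or of its anticomplementary triangle. Assume that $H=A$, $O=D_0$, and $D_3$ is the midpoint of $AP'$. Then the conic $\tilde{\mathcal{C}}_O = \iota(l)$, where $l=K^{-1}(AQ)=K^{-2}(BC)$ is the line through the reflection $\tilde{A}$ of $A$ in $O$ parallel to the side $BC$. The points $O, O', P, P'$ are collinear, with $d(O,P')=3d(O,P)$, and the map $\textsf{M}=T_PK^{-1}T_{P'}$ taking $\tilde{\mathcal{C}}_O$ to the inconic $\mathcal{I}$ is a translation. In this situation, the point $P$ is one of the two points in the intersection $l_G \cap \tilde{\mathcal{C}}_O$, where $l_G$ is the line through the centroid $G$ which is parallel to $BC$.
   Context: We work in the Euclidean plane extended by the line at infinity $l_\infty$; affine maps act on the extended plane; juxtaposition of maps is composition; $d$ is Euclidean distance. Two lines are parallel if they meet $l_\infty$ in the same point (a line is parallel to itself). Products of lines such as $AP\cdot BC$ denote intersection points. The center of a conic is the pole of $l_\infty$ with respect to it. $ABC$ is a triangle with centroid $G$; $D_0,E_0,F_0$ are the midpoints of $BC,CA,AB$. $K$ is the complement map, the homothety with center $G$ and ratio $-1/2$; $K^{-1}(ABC)$ is the anticomplementary triangle. $P$ is a point not on the extended sides of $ABC$ or $K^{-1}(ABC)$. $D=AP\cdot BC$, $E=BP\cdot CA$, $F=CP\cdot AB$ are its traces. $D_3,E_3,F_3$ are the reflections of $D,E,F$ in $D_0,E_0,F_0$; the lines $AD_3,BE_3,CF_3$ concur in $P'=\iota(P)$, the isotomic conjugate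 of $P$. In barycentric coordinates $\iota(x:y:z)=(1/x:1/y:1/z)$; for a line $l:\alpha x+\beta y+\gamma z=0$, $\iota(l)$ denotes the circumconic $\alpha yz+\beta zx+\gamma xy=0$ of $ABC$. $Q=K(P')$, $Q'=K(P)$. $T_P$ and $T_{P'}$ are the unique affine maps taking $A,B,C$ to $D,E,F$ and to $D_3,E_3,F_3$, respectively. The generalized circumcenter $O$ of $P$ is the point lying on the lines through $D_0,E_0,F_0$ parallel respectively to $QD,QE,QF$; the generalized orthocenter $H$ is the point lying on the lines through $A,B,C$ parallel respectively to $QD,QE,QF$. One has $O=T_{P'}^{-1}K(Q)$ and $H=K^{-1}(O)$. $O'=T_P^{-1}K(Q')$ is the generalized circumcenter of $P'$. The nine-point conic $\mathcal{N}_{P'}$ of the quadrangle $ABCP'$ (with respect to $l_\infty$) is the locus of centers of the conics through $A,B,C,P'$ (the center of a pair of opposite sides being their intersection); it passes through the diagonal points $D_3,E_3,F_3$ and the midpoints of the six sides. $\tilde{\mathcal{C}}_O=T_{P'}^{-1}(\mathcal{N}_{P'})$ is a circumconic of $ABC$ with center $O$. $\mathcal{I}$ is the inconic of $P$: the conic tangent to $BC,CA,AB$ at $D,E,F$; its center is $Q$. The map $\textsf{M}$ is a homothety or translation taking $\tilde{\mathcal{C}}_O$ to $\mathcal{I}$. *)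

(* Defs.v *)
From HB Require Import structures.
From mathcomp Require Import all_boot all_order all_algebra.
From mathcomp Require Import boolp classical_sets reals.

Set Implicit Arguments.
Unset Strict Implicit.
Unset Printing Implicit Defensive.

Import Order.TTheory GRing.Theory Num.Theory.
Local Open Scope classical_set_scope.
Local Open Scope ring_scope.

Section ExtendedPlane.
Variable R : realType.

(* The matrix norm of the libraries is the sup norm, hence this definition. *)
Definition dist (p q : 'rV[R]_2) : R :=
  Num.sqrt (\sum_(i < 2) (p 0 i - q 0 i) ^+ 2).

Definition midpoint (p q : 'rV[R]_2) : 'rV[R]_2 := 2^-1 *: (p + q).

(* The extended plane is the projective plane of 'rV_3: its points and lines
   are the subspaces of dimension 1 and 2, incidence is inclusion, the join of
   two points is their sum and the meet of two lines is their intersection. *)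
Definition hvec := 'rV[R]_(2 + 1).
Definition flat := {vspace hvec}.

Definition is_point (U : flat) : Prop := \dim U = 1%N.
Definition is_line (L : flat) : Prop := \dim L = 2%N.
Definition points_of (L : flat) : set flat :=
  [set U | is_point U /\ (U <= L)%VS].

Definition collinear (S : set flat) : Prop :=
  exists2 L, is_line L & S `<=` points_of L.

Definition hom (p : 'rV[R]_2) : hvec := row_mx p (1 : 'rV[R]_1).
Definition pt (p : 'rV[R]_2) : flat := <[hom p]>%VS.
Definition linf : flat := lker (linfun (@rsubmx R 1 2 1)).

Lemma mem_linf u : (u \in linf) = (rsubmx u == 0).
Proof. by rewrite memv_ker lfunE. Qed.

Definition parallel (L M : flat) : Prop := (L :&: linf = M :&: linf)%VS.
Definition parallel_through (U L : flat) : flat := (U + (L :&: linf))%VS.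

Definition affine_map (f : 'End(hvec)) : Prop :=
  lker f = 0%VS /\ forall p, exists q, f (hom p) = hom q.

Definition translation (f : 'End(hvec)) : Prop :=
  exists v, forall p, f (hom p) = hom (p + v).

Definition homothety (c : 'rV[R]_2) (k : R) : 'End(hvec) :=
  linfun (mulmxr (block_mx k%:M 0 ((1 - k) *: c) 1%:M : 'M[R]_(2 + 1))).

Lemma homothetyE c k p : homothety c k (hom p) = hom (c + k *: (p - c)).
Proof.
rewrite /homothety lfunE /= /hom mul_row_block mulmx0 add0r mulmx1.
rewrite mul_mx_scalar mul1mx; congr row_mx.
by rewrite scalerBr scalerBl scale1r addrCA.
Qed.

Definition reflection (c : 'rV[R]_2) : 'End(hvec) := homothety c (-1).

Definition map_set (f : 'End(hvec)) (S : set flat) : set flat :=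
  [set (f @: U)%VS | U in S].

(* Conics are given by symmetric forms u *m S *m v^T, up to a scalar. *)
Definition locus (S : 'M[R]_(2 + 1)) : set flat :=
  [set U | is_point U /\ forall u, u \in U -> u *m S *m u^T = 0].

Definition nondegenerate_form (S : 'M[R]_(2 + 1)) : Prop :=
  S^T = S /\ S \in unitmx.

Definition is_pole (S : 'M[R]_(2 + 1)) (L X : flat) : Prop :=
  is_point X /\ forall u v, u \in X -> v \in L -> u *m S *m v^T = 0.

Definition is_conic (C : set flat) : Prop :=
  exists2 S, nondegenerate_form S & C = locus S.

(* Over a field, a line is tangent to a conic at X exactly when X is their
   only common point in the projective plane. *)
Definition tangent_at (C : set flat) (L X : flat) : Prop :=
  C `&` points_of L = [set X].

End ExtendedPlane.

Section CevianGeometry.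
Variable R : realType.
Implicit Types (A B C : 'rV[R]_2) (P l : flat R).

Definition noncollinear A B C : Prop := (pt A + pt B + pt C)%VS = fullv.

Definition centroid A B C : 'rV[R]_2 := 3^-1 *: (A + B + C).

Definition complement_map A B C : 'End(hvec R) :=
  homothety (centroid A B C) (- 2^-1).

Definition not_on_sides A B C P : Prop :=
  [/\ ~ (P <= pt B + pt C)%VS, ~ (P <= pt C + pt A)%VS
    & ~ (P <= pt A + pt B)%VS].

Definition not_on_anticomplementary_sides A B C P : Prop :=
  let Kinv := ((complement_map A B C)^-1)%VF in
  [/\ ~ (P <= Kinv @: (pt B + pt C))%VS, ~ (P <= Kinv @: (pt C + pt A))%VS
    & ~ (P <= Kinv @: (pt A + pt B))%VS].

(* D and D_3; the traces on the other two sides are obtained by permuting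
   A, B, C cyclically. *)
Definition trace A B C P : flat R := ((pt A + P) :&: (pt B + pt C))%VS.
Definition refl_trace A B C P : flat R :=
  (reflection (midpoint B C) @: trace A B C P)%VS.

Definition isotomic A B C P : flat R :=
  ((pt A + refl_trace A B C P) :&: (pt B + refl_trace B C A P)
   :&: (pt C + refl_trace C A B P))%VS.

Definition isotomcomplement A B C P : flat R :=
  (complement_map A B C @: isotomic A B C P)%VS.

Definition gen_circumcenter A B C P : flat R :=
  let Q := isotomcomplement A B C P in
  (parallel_through (pt (midpoint B C)) (Q + trace A B C P)
   :&: parallel_through (pt (midpoint C A)) (Q + trace B C A P)
   :&: parallel_through (pt (midpoint A B)) (Q + trace C A B P))%VS.

Definition gen_orthocenter A B C P : flat R :=
  let Q := isotomcomplement A B C P in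
  (parallel_through (pt A) (Q + trace A B C P)
   :&: parallel_through (pt B) (Q + trace B C A P)
   :&: parallel_through (pt C) (Q + trace C A B P))%VS.

Definition barycentric A B C (x y z : R) : hvec R :=
  x *: hom A + y *: hom B + z *: hom C.

Definition has_equation A B C l (a b c : R) : Prop :=
  forall x y z,
    barycentric A B C x y z \in l <-> a * x + b * y + c * z = 0.

Definition isotomic_line A B C l : set (flat R) :=
  [set U | is_point U /\ exists a b c x y z,
     [/\ has_equation A B C l a b c, U = <[barycentric A B C x y z]>%VS
       & a * (y * z) + b * (z * x) + c * (x * y) = 0]].

(* The nine-point conic with respect to linf, for the quadrangle A B C X.
   Degenerate conics through the four points are the pairs of opposite sides,
   whose center is by convention the diagonal point. *)
Definition nine_point_conic A B C (X : flat R) : set (flat R) :=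
  [set U | (exists S, [/\ nondegenerate_form S,
              [set pt A; pt B; pt C; X] `<=` locus S & is_pole S (linf R) U])
           \/ [\/ U = ((pt A + X) :&: (pt B + pt C))%VS,
                  U = ((pt B + X) :&: (pt C + pt A))%VS
                | U = ((pt C + X) :&: (pt A + pt B))%VS]].

Definition maps_triangle A B C (f : 'End(hvec R)) (D E F : flat R) : Prop :=
  [/\ affine_map f, (f @: pt A)%VS = D, (f @: pt B)%VS = E
    & (f @: pt C)%VS = F].

Definition is_inconic A B C P (I : set (flat R)) : Prop :=
  [/\ is_conic I, tangent_at I (pt B + pt C)%VS (trace A B C P),
      tangent_at I (pt C + pt A)%VS (trace B C A P)
    & tangent_at I (pt A + pt B)%VS (trace C A B P)].

End CevianGeometry.

(* Main.v *)
(* In barycentric coordinates write P = (x : y : z).  The condition H = A forces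
   BA to be parallel to QE, which reads x^2 = xy + yz + zx; and D_3 is the
   midpoint of AP' when xy + yz + zx = - yz.  Hence y + z = 2 x and yz = - x^2,
   so that P = (1 : 1 + s : 1 - s) with s^2 = 2.  Everything else is then a
   computation over Q(s): the nine-point conic of ABCP' is
     x u (v + w - u) + y v (w + u - v) + z w (u + v - w) = 0,
   its preimage under T_P' is 2 vw + wu + uv = 0, the line l is 2 u + v + w = 0,
   and the map M adds (u + v + w)(1, (s - 1)/2, - (s + 1)/2) to (u, v, w). *)
From HB Require Import structures.
From mathcomp Require Import all_boot all_order all_algebra ring lra.
From mathcomp Require Import boolp classical_sets reals.
Require Import Defs.

Set Implicit Arguments.
Unset Strict Implicit.
Unset Printing Implicit Defensive.

Import Order.TTheory GRing.Theory Num.Theory.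
Local Open Scope classical_set_scope.
Local Open Scope ring_scope.

(** The hard part is the nine-point conic, which is given as a set of centers and not by an
    equation. The circumconics a vw + b wu + c uv = 0 through P' are those with a x + b y + c z = 0.
    The center (u : v : w) of such a conic satisfies b w + c v = a w + c u = a v + b u, which is
    solved by (a : b : c) = (u (v + w - u) : v (w + u - v) : w (u + v - w)); inserting this in the
    linear condition gives the equation of the locus. The converse has to produce a nondegenerate
    conic for every point of that curve, and the formula degenerates on the sides of ABC, where
    midpoints and diagonal points need separate care. Two constants have a geometric meaning: the
    vector of the translation is Q - O, because centers correspond, and in normalized coordinates P'
    - O = -3 (P - O), which gives the ratio of distances. *)

Lemma proportional (F : fieldType) (x y z x' y' z' : F) :
  [|| x' != 0, y' != 0 | z' != 0] ->
  y * z' = z * y' -> z * x' = x * z' -> x * y' = y * x' ->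
  exists k, [/\ x = k * x', y = k * y' & z = k * z'].
Proof.
move=> n0 e1 e2 e3; case/or3P: n0 => h.
- by exists (x / x'); rewrite divfK // ![x / x' * _]mulrAC e3 -e2 !mulfK.
- by exists (y / y'); rewrite divfK // ![y / y' * _]mulrAC e1 -e3 !mulfK.
- by exists (z / z'); rewrite divfK // ![z / z' * _]mulrAC e2 -e1 !mulfK.
Qed.

(** * Barycentric coordinates: incidence, the maps of the triangle, symmetric forms *)

Section Barycentric.
Variables (R : realType) (A B C : 'rV[R]_2).
Local Notation bar := (barycentric A B C).
Local Notation eqn := (has_equation A B C).

Lemma barD x y z x' y' z' :
  bar x y z + bar x' y' z' = bar (x + x') (y + y') (z + z').
Proof.
rewrite /barycentric !scalerDl !addrA [RHS]addrC.
by apply/rowP=> i; rewrite !mxE; ring.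
Qed.

Lemma barZ k x y z : k *: bar x y z = bar (k * x) (k * y) (k * z).
Proof. by rewrite /barycentric !scalerDr !scalerA. Qed.

Lemma hom_barA : hom A = bar 1 0 0.
Proof. by rewrite /barycentric scale1r !scale0r !addr0. Qed.

Lemma hom_barB : hom B = bar 0 1 0.
Proof. by rewrite /barycentric scale1r !scale0r add0r addr0. Qed.

Lemma hom_barC : hom C = bar 0 0 1.
Proof. by rewrite /barycentric scale1r !scale0r !add0r. Qed.

(** The last homogeneous coordinate is the total weight. Hence [linf] has equation x + y + z = 0,
    and [hom p] is the representative of total weight 1. *)
Lemma bar_row x y z :
  bar x y z = row_mx (x *: A + y *: B + z *: C) (x + y + z)%:M.
Proof.
rewrite /barycentric /hom !scale_row_mx !add_row_mx; congr row_mx.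
by apply/rowP=> i; rewrite !mxE !ord1 eqxx; ring.
Qed.

Lemma hom_bar x y z p : x + y + z = 1 -> p = x *: A + y *: B + z *: C ->
  hom p = bar x y z.
Proof. by move=> s1 ->; rewrite bar_row s1; congr row_mx. Qed.

Lemma mem_linf_bar x y z : (bar x y z \in linf R) = (x + y + z == 0).
Proof.
rewrite mem_linf bar_row row_mxKr; apply/eqP/eqP => [/rowP/(_ 0)|->].
  by rewrite !mxE eqxx.
by apply/rowP=> i; rewrite !mxE mul0rn.
Qed.

Lemma lfun_bar (f : 'End(hvec R)) x y z :
  f (bar x y z) = x *: f (hom A) + y *: f (hom B) + z *: f (hom C).
Proof. by rewrite /barycentric !linearD !linearZ. Qed.

Lemma bar_cyc x y z : barycentric B C A y z x = bar x y z.
Proof. by rewrite /barycentric addrC addrA. Qed.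

Lemma line_barZ k x y z : k != 0 ->
  <[bar (k * x) (k * y) (k * z)]>%VS = <[bar x y z]>%VS.
Proof.
move=> k0; rewrite -barZ; apply/eqP; rewrite eqEsubv -!memvE.
rewrite memvZ ?memv_line //=; apply/vlineP; exists k^-1.
by rewrite scalerA mulVf // scale1r.
Qed.

(** The reflection in the midpoint of BC exchanges B and C and sends A to B + C - A; the rest is
    linearity. *)
Lemma reflection_bar u v w :
  reflection (midpoint B C) (bar u v w) = bar (- u) (u + w) (u + v).
Proof.
have side x y z p : x + y + z = 1 -> midpoint B C + -1 *: (p - midpoint B C)
    = x *: A + y *: B + z *: C -> reflection (midpoint B C) (hom p) = bar x y z.
  by move=> s1 e; rewrite homothetyE; apply: hom_bar.
have -> : bar (- u) (u + w) (u + v)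
    = u *: bar (-1) 1 1 + v *: bar 0 0 1 + w *: bar 0 1 0.
  by rewrite !barZ !barD; congr barycentric; ring.
rewrite lfun_bar; congr (_ *: _ + _ *: _ + _ *: _); apply: side; try ring.
- by rewrite /midpoint; apply/rowP=> i; rewrite !mxE; field.
- by rewrite /midpoint; apply/rowP=> i; rewrite !mxE; field.
- by rewrite /midpoint; apply/rowP=> i; rewrite !mxE; field.
Qed.

Lemma complement_bar u v w : complement_map A B C (bar u v w) =
  bar (2^-1 * (v + w)) (2^-1 * (w + u)) (2^-1 * (u + v)).
Proof.
have side x y z p : x + y + z = 1 ->
    centroid A B C + - 2^-1 *: (p - centroid A B C) = x *: A + y *: B + z *: C ->
    complement_map A B C (hom p) = bar x y z.
  by move=> s1 e; rewrite homothetyE; apply: hom_bar.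
have -> : bar (2^-1 * (v + w)) (2^-1 * (w + u)) (2^-1 * (u + v)) =
    u *: bar 0 2^-1 2^-1 + v *: bar 2^-1 0 2^-1 + w *: bar 2^-1 2^-1 0.
  by rewrite !barZ !barD; congr barycentric; ring.
rewrite lfun_bar; congr (_ *: _ + _ *: _ + _ *: _); apply: side; try by field.
- by rewrite /centroid; apply/rowP=> i; rewrite !mxE; field.
- by rewrite /centroid; apply/rowP=> i; rewrite !mxE; field.
- by rewrite /centroid; apply/rowP=> i; rewrite !mxE; field.
Qed.

Hypothesis nc : noncollinear A B C.

Let basis_mx : 'M[R]_(3, 2 + 1) :=
  \matrix_(i, j) [:: hom A; hom B; hom C]`_i 0 j.

Let bar_basis_mx x y z : bar x y z = (\row_(i < 3) [:: x; y; z]`_i) *m basis_mx.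
Proof. by apply/rowP=> i; rewrite !mxE !big_ord_recr big_ord0 /= !mxE /= add0r. Qed.

Lemma bar_surj v : exists x y z, v = bar x y z.
Proof.
have : v \in fullv by apply: memvf.
rewrite -nc => /memv_addP[u /memv_addP[a /vlineP[x ->] [b /vlineP[y ->] ->]]].
by move=> [c /vlineP[z ->] ->]; exists x, y, z.
Qed.

Let basis_mx_unit : basis_mx \in unitmx.
Proof.
(* Every vector is a combination of the rows of [basis_mx], in particular every row of the identity
   matrix. *)
rewrite -row_full_unit -sub1mx; apply/row_subP=> i.
by have [x [y [z ->]]] := bar_surj (row i 1%:M); rewrite bar_basis_mx submxMl.
Qed.

Lemma bar_inj x y z x' y' z' : bar x y z = bar x' y' z' ->
  [/\ x = x', y = y' & z = z'].
Proof.
rewrite !bar_basis_mx => /(can_inj (mulmxK basis_mx_unit))/rowP e.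
by split; [move: (e 0)|move: (e 1)|move: (e 2)]; rewrite !mxE.
Qed.

Lemma bar_eq0 x y z : (bar x y z == 0) = [&& x == 0, y == 0 & z == 0].
Proof.
have bar0 : bar 0 0 0 = 0 by rewrite /barycentric !scale0r !addr0.
apply/eqP/and3P => [|[/eqP-> /eqP-> /eqP->] //].
by rewrite -bar0 => /bar_inj[-> -> ->].
Qed.

Lemma is_point_bar x y z :
  is_point <[bar x y z]>%VS <-> [|| x != 0, y != 0 | z != 0].
Proof.
rewrite /is_point dim_vline bar_eq0 !negb_and.
by case: [|| _, _ | _].
Qed.

Lemma is_pointP (U : flat R) : is_point U -> exists x y z,
  U = <[bar x y z]>%VS /\ [|| x != 0, y != 0 | z != 0].
Proof.
move=> dU; have [x [y [z e]]] := bar_surj (vpick U).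
exists x, y, z; have U0 : (U != 0)%VS by rewrite -dimv_eq0 dU.
have e1 : U = <[bar x y z]>%VS.
  apply/esym/eqP; rewrite -e eqEdim -memvE memv_pick dim_vline vpick0.
  by rewrite U0 dU.
by split=> //; apply/is_point_bar; rewrite -e1.
Qed.

Lemma line_bar_eq x y z x' y' z' : [|| x' != 0, y' != 0 | z' != 0] ->
  y * z' = z * y' -> z * x' = x * z' -> x * y' = y * x' ->
  [|| x != 0, y != 0 | z != 0] ->
  <[bar x y z]>%VS = <[bar x' y' z']>%VS.
Proof.
move=> n0 e1 e2 e3; have [k [-> -> ->]] := proportional n0 e1 e2 e3.
move=> n0'; rewrite line_barZ //; apply/eqP => k0; move: n0'.
by rewrite k0 !mul0r eqxx.
Qed.

Lemma equation_inj L M a b c : eqn L a b c -> eqn M a b c -> L = M.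
Proof.
move=> hL hM; apply/vspaceP=> v; have [x [y [z ->]]] := bar_surj v.
by apply/idP/idP => [/hL/hM|/hM/hL].
Qed.

Lemma linf_equation : eqn (linf R) 1 1 1.
Proof. by move=> x y z; rewrite mem_linf_bar !mul1r; split=> /eqP. Qed.

Lemma join_equation x y z x' y' z'
    (a := y * z' - z * y') (b := z * x' - x * z') (c := x * y' - y * x') :
  [|| a != 0, b != 0 | c != 0] ->
  eqn (<[bar x y z]> + <[bar x' y' z']>)%VS a b c.
Proof.
move=> n0 u v w; split.
  case/memv_addP=> _ /vlineP[s ->] [_ /vlineP[t ->]].
  rewrite !barZ barD => /bar_inj[-> -> ->]; rewrite /a /b /c; ring.
(* Cramer's rule: for a nonvanishing minor k, the vector multiplied by k is an explicit combination
   of the two generators. *)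
move=> e; have memk (k s t : R) : k != 0 -> k * u = s * x + t * x' ->
    k * v = s * y + t * y' -> k * w = s * z + t * z' ->
    bar u v w \in (<[bar x y z]> + <[bar x' y' z']>)%VS.
  move=> k0 eu ev ew; rewrite -[bar _ _ _]scale1r -(mulVf k0) -scalerA barZ.
  by rewrite eu ev ew -barD -!barZ memvZ // memv_add // memvZ // memv_line.
case/or3P: n0 => h.
- apply: (memk a (v * z' - w * y') (y * w - z * v)) => //.
  + by apply/eqP; rewrite -subr_eq0 -e; apply/eqP; rewrite /a /b /c; ring.
  + by rewrite /a; ring.
  + by rewrite /a; ring.
- apply: (memk b (w * x' - u * z') (z * u - x * w)) => //.
  + by rewrite /b; ring.
  + by apply/eqP; rewrite -subr_eq0 -e; apply/eqP; rewrite /a /b /c; ring.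
  + by rewrite /b; ring.
- apply: (memk c (u * y' - v * x') (x * v - y * u)) => //.
  + by rewrite /c; ring.
  + by rewrite /c; ring.
  + by apply/eqP; rewrite -subr_eq0 -e; apply/eqP; rewrite /a /b /c; ring.
Qed.

Lemma is_line_join x y z x' y' z' :
  [|| y * z' - z * y' != 0, z * x' - x * z' != 0 | x * y' - y * x' != 0] ->
  is_line (<[bar x y z]> + <[bar x' y' z']>)%VS.
Proof.
move=> n0; rewrite /is_line dimv_disjoint_sum.
  rewrite !dim_vline !bar_eq0.
  case: (boolP [&& x == 0, _ & _]) n0 => [/and3P[/eqP-> /eqP-> /eqP->]|_].
    by rewrite !mul0r !subr0 eqxx.
  case: (boolP [&& x' == 0, _ & _]) => [/and3P[/eqP-> /eqP-> /eqP->]|//].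
  by rewrite !mulr0 !subr0 eqxx.
apply/eqP; rewrite -subv0; apply/subvP => v /memv_capP[/vlineP[k ->]].
case/vlineP=> t; rewrite !barZ => /bar_inj[ex ey ez]; rewrite memv0 bar_eq0.
suff -> : k = 0 by rewrite !mul0r eqxx.
apply/eqP/negPn/negP => k0; move: n0.
have mk (r : R) : k * r = 0 -> r = 0.
  by move/eqP; rewrite mulf_eq0 (negPf k0) => /eqP.
have e1 : y * z' - z * y' = 0 by apply: mk; rewrite mulrBr !mulrA ey ez; ring.
have e2 : z * x' - x * z' = 0 by apply: mk; rewrite mulrBr !mulrA ez ex; ring.
have e3 : x * y' - y * x' = 0 by apply: mk; rewrite mulrBr !mulrA ex ey; ring.
by rewrite e1 e2 e3 eqxx.
Qed.

Lemma meet_equations L M x y z x' y' z' 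
    (a := y * z' - z * y') (b := z * x' - x * z') (c := x * y' - y * x') :
  [|| a != 0, b != 0 | c != 0] -> eqn L x y z -> eqn M x' y' z' ->
  (L :&: M)%VS = <[bar a b c]>%VS.
Proof.
move=> n0 hL hM; apply/eqP; rewrite eqEsubv -memvE memv_cap.
apply/andP; split; last first.
  by apply/andP; split; [apply/hL|apply/hM]; rewrite /a /b /c; ring.
apply/subvP=> t; have [u [v [w ->]]] := bar_surj t.
move=> /memv_capP[/hL e /hM e'].
have memk (k s : R) : k != 0 -> k * u = s * a -> k * v = s * b ->
    k * w = s * c -> bar u v w \in <[bar a b c]>%VS.
  move=> k0 eu ev ew; rewrite -[bar u v w]scale1r -(mulVf k0) -scalerA barZ.
  by rewrite eu ev ew -barZ !memvZ ?memv_line.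
have lin (p q r s : R) : p - q = r * (x * u + y * v + z * w)
    + s * (x' * u + y' * v + z' * w) -> p = q.
  by rewrite e e' !mulr0 addr0 => /eqP; rewrite subr_eq0 => /eqP.
case/or3P: n0 => h.
- apply: (memk a u h); rewrite /a /b /c; first by ring.
    by apply: (lin _ _ z' (- z)); ring.
  by apply: (lin _ _ (- y') y); ring.
- apply: (memk b v h); rewrite /a /b /c; last 1 first.
  + by apply: (lin _ _ x' (- x)); ring.
  + by apply: (lin _ _ (- z') z); ring.
  + by ring.
- apply: (memk c w h); rewrite /a /b /c; last by ring.
    by apply: (lin _ _ y' (- y)); ring.
  by apply: (lin _ _ (- x') x); ring.
Qed.

Lemma lker_complement : lker (complement_map A B C) == 0%VS.
Proof.
apply/eqP/eqP; rewrite -subv0; apply/subvP=> t.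
have [u [v [w ->]]] := bar_surj t.
rewrite memv_ker complement_bar memv0 !bar_eq0 => /and3P[/eqP e1 /eqP e2 /eqP e3].
by apply/and3P; split; apply/eqP; lra.
Qed.

Lemma complement_inv_bar u v w : ((complement_map A B C)^-1)%VF (bar u v w) =
  bar (v + w - u) (w + u - v) (u + v - w).
Proof.
apply: (canLR (lker0_lfunK lker_complement)).
by rewrite complement_bar; congr barycentric; field.
Qed.

(** Variant in which the equation is proposed by the user: two points determine their line up to a
    factor, so it is enough that both satisfy it. This permits coefficients simplified by s^2 = 2.
    [meet_equationsW] is the dual. *)
Lemma join_equationW a b c x y z x' y' z' :
  [|| y * z' - z * y' != 0, z * x' - x * z' != 0 | x * y' - y * x' != 0] ->
  [|| a != 0, b != 0 | c != 0] ->
  a * x + b * y + c * z = 0 -> a * x' + b * y' + c * z' = 0 ->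
  eqn (<[bar x y z]> + <[bar x' y' z']>)%VS a b c.
Proof.
move=> n0 n0' e e'; have h := join_equation n0.
have lin (p q r s : R) : p - q = r * (a * x + b * y + c * z)
    + s * (a * x' + b * y' + c * z') -> p = q.
  by rewrite e e' !mulr0 addr0 => /eqP; rewrite subr_eq0 => /eqP.
have [|||k [ea eb ec]] := @proportional _ (y * z' - z * y') (z * x' - x * z')
  (x * y' - y * x') a b c n0'.
- by apply: (lin _ _ x' (- x)); ring.
- by apply: (lin _ _ y' (- y)); ring.
- by apply: (lin _ _ z' (- z)); ring.
have k0 : k != 0.
  by apply/eqP => k0; move: n0; rewrite ea eb ec k0 !mul0r eqxx.
move=> u v w; rewrite h ea eb ec -!mulrA -!mulrDr; split=> [/eqP|->].
  by rewrite mulf_eq0 (negPf k0) => /eqP.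
by rewrite mulr0.
Qed.

Lemma meet_equationsW u v w L M x y z x' y' z' :
  [|| y * z' - z * y' != 0, z * x' - x * z' != 0 | x * y' - y * x' != 0] ->
  [|| u != 0, v != 0 | w != 0] -> eqn L x y z -> eqn M x' y' z' ->
  x * u + y * v + z * w = 0 -> x' * u + y' * v + z' * w = 0 ->
  (L :&: M)%VS = <[bar u v w]>%VS.
Proof.
move=> n0 n0' hL hM e e'; rewrite (meet_equations n0 hL hM); apply/esym/eqP.
rewrite eqEdim -memvE -(meet_equations n0 hL hM) memv_cap.
rewrite (meet_equations n0 hL hM) !dim_vline !bar_eq0 !negb_and n0 n0' andbT.
by apply/andP; split; [apply/hL|apply/hM].
Qed.

(** [S0] is the Gram matrix in the basis [hom A], [hom B], [hom C]; conjugating by the change of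
    basis turns it into a form on [hvec]. *)
Lemma symmetric_form p q r a b c : exists S : 'M[R]_(2 + 1), S^T = S /\
  forall x y z x' y' z', bar x y z *m S *m (bar x' y' z')^T =
    (p * (x * x') + q * (y * y') + r * (z * z') + a * (y * z' + z * y')
     + b * (z * x' + x * z') + c * (x * y' + y * x'))%:M.
Proof.
pose S0 : 'M[R]_3 := \matrix_(i, j)
  nth 0 (nth [::] [:: [:: p; c; b]; [:: c; q; a]; [:: b; a; r]] i) j.
exists (invmx basis_mx *m S0 *m (invmx basis_mx)^T); split.
  rewrite !trmx_mul trmxK mulmxA; congr (_ *m _ *m _).
  apply/matrixP=> i j; rewrite !mxE.
  by case: i j => -[|[|[|//]]] ? [] [|[|[|//]]] ?.
move=> x y z x' y' z'; rewrite !bar_basis_mx trmx_mul !mulmxA mulmxK //.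
rewrite -!mulmxA [in X in _ *m (_ *m X)]mulmxA -trmx_mul mulmxV //.
rewrite trmx1 mul1mx.
apply/matrixP=> i j; rewrite !ord1 !mxE eqxx.
rewrite !big_ord_recr big_ord0 /= !mxE !big_ord_recr !big_ord0 /= !mxE /=.
ring.
Qed.

Lemma ker0_unitmx (S : 'M[R]_(2 + 1)) :
  (forall u : hvec R, u *m S = 0 -> u = 0) -> S \in unitmx.
Proof.
move=> h; rewrite -row_free_unit -kermx_eq0; apply/eqP/row_matrixP=> i.
by rewrite row0; apply: h; rewrite -row_mul mulmx_ker row0.
Qed.

End Barycentric.

Lemma noncollinear_cyc (R : realType) (A B C : 'rV[R]_2) :
  noncollinear A B C -> noncollinear B C A.
Proof. by rewrite /noncollinear -addvA addvC. Qed.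

Lemma neq0_or3 (R : realType) (a b c : R) :
  [\/ a <> 0, b <> 0 | c <> 0] -> [|| a != 0, b != 0 | c != 0].
Proof. by case=> /eqP h; rewrite h ?orbT. Qed.

(** * Traces on the side BC *)

Section Traces.
Variables (R : realType) (A B C : 'rV[R]_2).
Hypothesis nc : noncollinear A B C.
Local Notation bar := (barycentric A B C).
Local Notation eqn := (has_equation A B C).

Lemma ptA_bar : pt A = <[bar 1 0 0]>%VS.
Proof. by rewrite /pt (hom_barA A B C). Qed.

Lemma ptB_bar : pt B = <[bar 0 1 0]>%VS.
Proof. by rewrite /pt (hom_barB A B C). Qed.

Lemma ptC_bar : pt C = <[bar 0 0 1]>%VS.
Proof. by rewrite /pt (hom_barC A B C). Qed.


Lemma side_equation : eqn (pt B + pt C)%VS 1 0 0.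
Proof.
rewrite ptB_bar ptC_bar.
apply: (join_equationW nc); try ring; apply: neq0_or3; constructor 1; lra.
Qed.

Lemma trace_bar x y z : y != 0 ->
  trace A B C <[bar x y z]>%VS = <[bar 0 y z]>%VS.
Proof.
move=> y0; have /eqP y1 := y0; rewrite /trace ptA_bar.
apply: (@meet_equationsW _ _ _ _ nc _ _ _ _ _ 0 (- z) y 1 0 0).
- by apply: neq0_or3; constructor 2; lra.
- by rewrite y0 orbT.
- by apply: (join_equationW nc); try ring; apply: neq0_or3; constructor 3; lra.
- exact: side_equation.
- ring.
- ring.
Qed.

Lemma refl_trace_bar x y z : y != 0 ->
  refl_trace A B C <[bar x y z]>%VS = <[bar 0 z y]>%VS.
Proof.
move=> y0; rewrite /refl_trace trace_bar // limg_line reflection_bar.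
by rewrite oppr0 !add0r.
Qed.

End Traces.

(** * The other traces, the isotomic conjugate, and the determination of P *)

Section Cevians.
Variables (R : realType) (A B C : 'rV[R]_2).
Hypothesis nc : noncollinear A B C.
Local Notation bar := (barycentric A B C).
Local Notation eqn := (has_equation A B C).

Lemma side_equationB : eqn (pt C + pt A)%VS 0 1 0.
Proof.
move=> x y z; rewrite -bar_cyc (side_equation (noncollinear_cyc nc)).
by split=> ?; lra.
Qed.

Lemma side_equationC : eqn (pt A + pt B)%VS 0 0 1.
Proof.
move=> x y z; rewrite -2!bar_cyc.
rewrite (side_equation (noncollinear_cyc (noncollinear_cyc nc))).
by split=> ?; lra.
Qed.

Lemma trace_barB x y z : z != 0 ->
  trace B C A <[bar x y z]>%VS = <[bar x 0 z]>%VS.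
Proof.
by move=> z0; rewrite -!(bar_cyc A B C) (trace_bar (noncollinear_cyc nc)).
Qed.

Lemma trace_barC x y z : x != 0 ->
  trace C A B <[bar x y z]>%VS = <[bar x y 0]>%VS.
Proof.
by move=> x0; rewrite -!(bar_cyc A B C) -!(bar_cyc B C A)
  (trace_bar (noncollinear_cyc (noncollinear_cyc nc))).
Qed.

Lemma refl_trace_barB x y z : z != 0 ->
  refl_trace B C A <[bar x y z]>%VS = <[bar z 0 x]>%VS.
Proof.
by move=> z0; rewrite -!(bar_cyc A B C) (refl_trace_bar (noncollinear_cyc nc)).
Qed.

Lemma refl_trace_barC x y z : x != 0 ->
  refl_trace C A B <[bar x y z]>%VS = <[bar y x 0]>%VS.
Proof.
by move=> x0; rewrite -!(bar_cyc A B C) -!(bar_cyc B C A)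
  (refl_trace_bar (noncollinear_cyc (noncollinear_cyc nc))).
Qed.

Lemma isotomic_bar x y z : x != 0 -> y != 0 -> z != 0 ->
  isotomic A B C <[bar x y z]>%VS = <[bar (y * z) (z * x) (x * y)]>%VS.
Proof.
move=> x0 y0 z0; rewrite /isotomic refl_trace_bar // refl_trace_barB //.
rewrite refl_trace_barC // (ptA_bar A B C) (ptB_bar A B C) (ptC_bar A B C).
have [/eqP x1 /eqP y1 /eqP z1] := And3 x0 y0 z0.
have eA : eqn (<[bar 1 0 0]> + <[bar 0 z y]>)%VS 0 (- y) z.
  by apply: (join_equationW nc); try ring; apply: neq0_or3; constructor 3; lra.
have eB : eqn (<[bar 0 1 0]> + <[bar z 0 x]>)%VS x 0 (- z).
  by apply: (join_equationW nc); try ring; apply: neq0_or3; constructor 1; lra.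
have eC : eqn (<[bar 0 0 1]> + <[bar y x 0]>)%VS (- x) y 0.
  by apply: (join_equationW nc); try ring; apply: neq0_or3;
     [constructor 2|constructor 2]; lra.
have xy0 : x * y <> 0 by apply/eqP; rewrite mulf_neq0.
rewrite (meet_equationsW nc (u := y * z) (v := z * x) (w := x * y) _ _ eA eB).
(* Concurrence: the meet of the first two cevians lies on the third, so the triple intersection is
   that point. *)
- by apply/capv_idPl; rewrite -memvE; apply/eC; ring.
- by apply: neq0_or3; constructor 3; lra.
- by apply: neq0_or3; constructor 3.
- ring.
- ring.
Qed.

Lemma isotomcomplement_bar x y z : x != 0 -> y != 0 -> z != 0 ->
  isotomcomplement A B C <[bar x y z]>%VS =
  <[bar (x * (y + z)) (y * (z + x)) (z * (x + y))]>%VS.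
Proof.
move=> x0 y0 z0; rewrite /isotomcomplement isotomic_bar // limg_line.
rewrite complement_bar -barZ -[RHS](@line_barZ _ _ _ _ 2^-1); last first.
  by rewrite invr_eq0 pnatr_eq0.
by rewrite -[in RHS]barZ; congr (<[_ *: barycentric _ _ _ _ _ _]>%VS); ring.
Qed.

Lemma hom_midpoint (p q : 'rV[R]_2) : hom (midpoint p q) = 2^-1 *: (hom p + hom q).
Proof.
rewrite /hom /midpoint add_row_mx scale_row_mx; congr row_mx.
by apply/rowP=> i; rewrite !mxE; field.
Qed.

Lemma bar_sum (p : 'rV[R]_2) x y z : hom p = bar x y z -> x + y + z = 1.
Proof.
rewrite bar_row /hom => /eq_row_mx[_ /rowP/(_ 0)].
by rewrite !mxE eqxx.
Qed.

Lemma special_point (P : flat R) :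
  is_point P -> not_on_sides A B C P -> not_on_anticomplementary_sides A B C P ->
  gen_orthocenter A B C P = pt A ->
  (exists2 p' : 'rV[R]_2, isotomic A B C P = pt p'
     & refl_trace A B C P = pt (midpoint A p')) ->
  exists2 s : R, s * s = 2 & P = <[bar 1 (1 + s) (1 - s)]>%VS.
Proof.
move=> /(is_pointP nc)[x [y [z [-> xyz0]]]].
rewrite /not_on_sides -!memvE => -[nA nB nC].
have x1 : x <> 0.
  by move=> x0; apply: nA; apply/(side_equation nc); rewrite x0; ring.
have y1 : y <> 0.
  by move=> y0; apply: nB; apply/side_equationB; rewrite y0; ring.
have z1 : z <> 0.
  by move=> z0; apply: nC; apply/side_equationC; rewrite z0; ring.
have [/eqP x0 /eqP y0 /eqP z0] := And3 x1 y1 z1.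
move=> [_ nB' _].
(* z + x = 0 is the equation of the anticomplementary side parallel to CA. Off this side Q differs
   from E, and QE is not the line at infinity. *)
have zx1 : z + x <> 0.
  move=> zx0; apply: nB'; rewrite limgD !(ptA_bar A B C) !(ptC_bar A B C) !limg_line.
  rewrite !complement_inv_bar // -memvE.
  apply/(@join_equationW _ _ _ _ nc 1 0 1); try ring.
  - by apply: neq0_or3; constructor 1; lra.
  - by apply: neq0_or3; constructor 1; lra.
  - by lra.
have /eqP zx0 := zx1.
move=> eH [p' eP' eD3].
(* Since H = A, the parallel to QE through B contains A, so the point at infinity of QE has no
   component along C. That component is z (xy + yz + zx - x^2). *)
have eS : x * x = x * y + y * z + z * x.
  have : hom A \in gen_orthocenter A B C <[bar x y z]>%VS.
    by rewrite eH memv_line.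
  rewrite /gen_orthocenter !memv_cap => /andP[/andP[_ +] _].
  rewrite isotomcomplement_bar // trace_barB // /parallel_through.
  rewrite (@meet_equationsW _ _ _ _ nc (x * (x * y + y * z + z * x - z * z))
     (- y * (z + x) * (z + x)) (z * (x * y + y * z + z * x - x * x)) _ _
     (y * z * (z + x)) (x * z * (x - z)) (- x * y * (z + x)) 1 1 1).
  - rewrite (ptB_bar A B C) (hom_barA A B C).
    case/memv_addP=> _ /vlineP[k ->] [_ /vlineP[t ->]].
    rewrite !barZ !barD => /(bar_inj nc)[e1 e2 e3].
    have t0 : t != 0 by apply/eqP => t0; move: e1; rewrite t0; lra.
    move: e3; rewrite mulr0 add0r => /esym/eqP.
    by rewrite !mulf_eq0 (negPf t0) (negPf z0) /= subr_eq0 => /eqP.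
  - apply: neq0_or3; constructor 2.
    have /eqP : y * (z + x) * (z + x) != 0 by rewrite !mulf_neq0.
    lra.
  - apply/or3P; constructor 2; by rewrite !mulf_neq0 // oppr_eq0.
  - apply: (join_equationW nc); try ring.
      apply/or3P; constructor 1; rewrite mulr0 subr0.
      by rewrite !mulf_neq0.
    by apply/or3P; constructor 1; rewrite !mulf_neq0.
  - exact: linf_equation.
  - ring.
  - ring.
(* D_3 is on BC, so the A-coordinate 1 + k yz of A + P' vanishes, where k normalizes P', that is k
   (xy + yz + zx) = 1. *)
have eyz : x * x = - (y * z).
  move: (memv_line (hom p')); rewrite -/(pt p') -eP' isotomic_bar //.
  case/vlineP=> k; rewrite barZ => ep'.
  move: (memv_line (hom (midpoint A p'))); rewrite -/(pt _) -eD3.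
  rewrite (refl_trace_bar nc) // hom_midpoint ep' (hom_barA A B C).
  case/vlineP=> j; rewrite barD !barZ => /(bar_inj nc)[e _ _].
  have := bar_sum ep' => e'.
  have k0 : k <> 0 by move=> k0; move: e'; rewrite k0; lra.
  apply: (mulfI (introN eqP k0)); rewrite eS; lra.
have yzx : y + z = 2 * x by apply: (mulfI x0); lra.
(* After scaling to x = 1, the numbers y and z have sum 2 and product -1, hence are 1 + s and 1 - s
   with s^2 = 2. *)
exists (y / x - 1).
  rewrite -[RHS](mulfK (mulf_neq0 x0 x0)).
  have -> : 2 * (x * x) = y * y - 2 * x * y + x * x.
    have ez : z = 2 * x - y by lra.
    by move: eyz; rewrite ez; lra.
  by field.
rewrite -[RHS](line_barZ A B C _ _ _ x0).
have -> : z = 2 * x - y by lra.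
by congr (<[barycentric _ _ _ _ _ _]>%VS); field.
Qed.

(** An affine map preserves total weight 1, so knowing the image as a subspace fixes the image
    vector: it is the normalized representative. *)
Lemma affine_image f p k a b c : affine_map f ->
  (f @: pt p = <[bar a b c]>)%VS -> k * (a + b + c) = 1 ->
  f (hom p) = k *: bar a b c.
Proof.
move=> [_ /(_ p)[q eq]]; rewrite limg_line eq => e s1.
have : hom q \in <[bar a b c]>%VS by rewrite -e memv_line.
case/vlineP=> j ej; rewrite ej; congr (_ *: _); move: ej; rewrite barZ.
move/bar_sum; rewrite -!mulrDr -s1; apply: mulIf.
by apply/eqP => h; move/eqP: s1; rewrite h mulr0 eq_sym oner_eq0.
Qed.

End Cevians.

(** * Coefficients, nondegeneracy and poles of symmetric forms *)

Section Forms.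
Variables (R : realType) (A B C : 'rV[R]_2).
Hypothesis nc : noncollinear A B C.
Local Notation bar := (barycentric A B C).

Definition form_coefficients (S : 'M[R]_(2 + 1)) (p q r a b c : R) :=
  forall x y z x' y' z', bar x y z *m S *m (bar x' y' z')^T =
    (p * (x * x') + q * (y * y') + r * (z * z') + a * (y * z' + z * y')
     + b * (z * x' + x * z') + c * (x * y' + y * x'))%:M.

Lemma form_coefficients_exist S : S^T = S ->
  exists p q r a b c, form_coefficients S p q r a b c.
Proof.
move=> sS; pose f (u v : hvec R) := (u *m S *m v^T) 0 0.
have fC u v : f u v = f v u.
  have -> : f u v = (u *m S *m v^T)^T 0 0 by rewrite [RHS]mxE.
  by rewrite !trmx_mul trmxK sS mulmxA.
exists (f (hom A) (hom A)), (f (hom B) (hom B)), (f (hom C) (hom C)).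
exists (f (hom B) (hom C)), (f (hom C) (hom A)), (f (hom A) (hom B)).
move=> x y z x' y' z'; apply/matrixP=> i j; rewrite !ord1 [RHS]mxE eqxx mulr1n.
have fD u v w : f (u + v) w = f u w + f v w by rewrite /f !mulmxDl mxE.
have fZ k u v : f (k *: u) v = k * f u v by rewrite /f -!scalemxAl mxE.
have fD' u v w : f w (u + v) = f w u + f w v by rewrite fC fD ![f _ w]fC.
have fZ' k u v : f v (k *: u) = k * f v u by rewrite fC fZ [f u v]fC.
rewrite -[LHS]/(f _ _) /barycentric !fD !fD' !fZ !fZ'.
rewrite [f (hom B) (hom A)]fC [f (hom C) (hom B)]fC [f (hom A) (hom C)]fC.
ring.
Qed.

Lemma form_eq0 (w : hvec R) : (forall v : hvec R, w *m v^T = 0) -> w = 0.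
Proof.
move=> h; apply/(@rowP _ (2 + 1))=> j; move: (h (delta_mx 0 j)).
by rewrite trmx_delta -colE => /matrixP/(_ 0 0); rewrite !mxE.
Qed.

Section Fixed.
Variables (S : 'M[R]_(2 + 1)) (p q r a b c : R).
Hypothesis fS : form_coefficients S p q r a b c.

Lemma form_unitmx :
  (forall u v w, p * u + c * v + b * w = 0 -> c * u + q * v + a * w = 0 ->
     b * u + a * v + r * w = 0 -> [/\ u = 0, v = 0 & w = 0]) ->
  S \in unitmx.
Proof.
move=> ker; apply: ker0_unitmx => t; have [u [v [w ->]]] := bar_surj nc t => e.
have ev x y z : p * (u * x) + q * (v * y) + r * (w * z) + a * (v * z + w * y)
     + b * (w * x + u * z) + c * (u * y + v * x) = 0.
  have := fS u v w x y z; rewrite e mul0mx => /matrixP/(_ 0 0).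
  by rewrite !mxE eqxx mulr1n.
have := ev 1 0 0; have := ev 0 1 0; have := ev 0 0 1 => e3 e2 e1.
have [-> -> ->] : [/\ u = 0, v = 0 & w = 0] by apply: ker; lra.
by rewrite /barycentric !scale0r !addr0.
Qed.

(** If these three coefficients vanish, then [hom A] is orthogonal to A, B and C, hence lies in the
    kernel of the form. *)
Lemma form_nonzero : S \in unitmx ->
  ~ [/\ p = 0, b = 0 & c = 0].
Proof.
move=> uS [p0 b0 c0].
have : hom A *m S = 0.
  apply: form_eq0 => v; have [x [y [z ->]]] := bar_surj nc v.
  rewrite (hom_barA A B C) fS p0 b0 c0.
  by apply/matrixP=> i j; rewrite !mxE !ord1 eqxx; ring.
move/(congr1 (mulmxr (invmx S))) => /=; rewrite mulmxK // mul0mx => /eqP.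
by rewrite (hom_barA A B C) (bar_eq0 nc) oner_eq0.
Qed.

Lemma locus_bar u v w : [|| u != 0, v != 0 | w != 0] ->
  locus S <[bar u v w]>%VS <->
  p * (u * u) + q * (v * v) + r * (w * w) + 2 * a * (v * w)
  + 2 * b * (w * u) + 2 * c * (u * v) = 0.
Proof.
move=> n0; split=> [[_ /(_ _ (memv_line _))]|e].
  rewrite fS => /matrixP/(_ 0 0); rewrite !mxE eqxx mulr1n => e; lra.
split=> [|_ /vlineP[k ->]]; first exact/(is_point_bar nc).
rewrite barZ fS; apply/matrixP=> i j; rewrite !ord1 !mxE eqxx mulr1n.
transitivity (k * k * (p * (u * u) + q * (v * v) + r * (w * w) +
  2 * a * (v * w) + 2 * b * (w * u) + 2 * c * (u * v))); first by ring.
by rewrite e mulr0.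
Qed.

End Fixed.

(** The polar of the point must be the line x + y + z = 0, so its three coefficients, the pairings
    of the point with A, B and C, have to agree. *)
Lemma pole_linf_bar S a b c u v w : form_coefficients S 0 0 0 a b c ->
  [|| u != 0, v != 0 | w != 0] ->
  is_pole S (linf R) <[bar u v w]>%VS <->
  b * w + c * v = a * w + c * u /\ a * w + c * u = a * v + b * u.
Proof.
move=> fS n0; split=> [[_ h]|[e1 e2]].
  have ev x y z : x + y + z = 0 ->
    a * (v * z + w * y) + b * (w * x + u * z) + c * (u * y + v * x) = 0.
    move=> s0; have l : bar x y z \in linf R by rewrite mem_linf_bar s0.
    have := h _ _ (memv_line _) l; rewrite fS => /matrixP/(_ 0 0).
    by rewrite !mxE eqxx mulr1n => e; lra.
  have := ev 1 (-1) 0; have := ev 0 1 (-1) => e2 e1.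
  by split; [have := e1 ltac:(lra)|have := e2 ltac:(lra)]; lra.
split=> [|_ t /vlineP[k ->]]; first exact/(is_point_bar nc).
have [x [y [z ->]]] := bar_surj nc t; rewrite mem_linf_bar => /eqP s0.
rewrite barZ fS; apply/matrixP=> i j; rewrite !ord1 !mxE eqxx mulr1n.
have -> : z = - x - y by lra.
transitivity (k * (x * ((b * w + c * v) - (a * v + b * u))
   + y * ((a * w + c * u) - (a * v + b * u)))); first by ring.
by rewrite e1 e2; ring.
Qed.

(** * Equation of the nine-point conic *)

Section NinePoint.
Variables x y z : R.
Hypotheses (x0 : x != 0) (y0 : y != 0) (z0 : z != 0).
Let X := <[bar (y * z) (z * x) (x * y)]>%VS.

Let is_point_X : [|| y * z != 0, z * x != 0 | x * y != 0].
Proof. by rewrite mulf_neq0. Qed.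

(* The conic [a yz + b zx + c xy = 0] passes through the isotomic conjugate of
   [(x : y : z)] when [a x + b y + c z = 0]. *)
Lemma nine_point_center a b c u v w : a <> 0 -> b <> 0 -> c <> 0 ->
  a * x + b * y + c * z = 0 ->
  b * w + c * v = a * w + c * u -> a * w + c * u = a * v + b * u ->
  [|| u != 0, v != 0 | w != 0] ->
  nine_point_conic A B C X <[bar u v w]>%VS.
Proof.
move=> a0 b0 c0 e e1 e2 n0; left.
have [S [sS fS]] := symmetric_form nc 0 0 0 a b c.
exists S; split; last by apply/(pole_linf_bar fS).
  split=> //; apply: (form_unitmx fS) => u' v' w' h1 h2 h3.
  have z1 (k t : R) : k <> 0 -> 2 * k * t = 0 -> t = 0.
    move=> /eqP/negPf k0 /eqP; rewrite !mulf_eq0 pnatr_eq0 k0 /=.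
    by move/eqP.
  have m0 (k t : R) : k <> 0 -> t <> 0 -> k * t <> 0.
    by move=> /eqP k0 /eqP t0; apply/eqP; rewrite mulf_neq0.
  split.
  (* The determinant of the system is 2abc. Weighting the rows by -a, b, c leaves 2bc u'; the next
     two cases follow cyclically. *)
  - apply: (z1 (b * c)); first exact: m0.
    transitivity (b * (c * u' + 0 * v' + a * w') + c * (b * u' + a * v' + 0 * w')
      - a * (0 * u' + c * v' + b * w')); first by ring.
    by rewrite h1 h2 h3; ring.
  - apply: (z1 (c * a)); first exact: m0.
    transitivity (c * (b * u' + a * v' + 0 * w') + a * (0 * u' + c * v' + b * w')
      - b * (c * u' + 0 * v' + a * w')); first by ring.
    by rewrite h1 h2 h3; ring.
  - apply: (z1 (a * b)); first exact: m0.
    transitivity (a * (0 * u' + c * v' + b * w') + b * (c * u' + 0 * v' + a * w')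
      - c * (b * u' + a * v' + 0 * w')); first by ring.
    by rewrite h1 h2 h3; ring.
have nA : [|| 1 != 0 :> R, 0 != 0 :> R | 0 != 0 :> R] by rewrite oner_eq0.
have nB : [|| 0 != 0 :> R, 1 != 0 :> R | 0 != 0 :> R] by rewrite oner_eq0 orbT.
have nC : [|| 0 != 0 :> R, 0 != 0 :> R | 1 != 0 :> R] by rewrite oner_eq0 !orbT.
move=> _ [[[->|->]|->]|->].
- by rewrite (ptA_bar A B C); apply/(locus_bar fS nA); ring.
- by rewrite (ptB_bar A B C); apply/(locus_bar fS nB); ring.
- by rewrite (ptC_bar A B C); apply/(locus_bar fS nC); ring.
apply/(locus_bar fS is_point_X).
transitivity (2 * x * y * z * (a * x + b * y + c * z)); first by ring.
by rewrite e mulr0.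
Qed.

Hypotheses (yz0 : y + z <> 0) (zx0 : z + x <> 0) (xy0 : x + y <> 0).
Hypotheses (yz1 : y <> z) (zx1 : z <> x) (xy1 : x <> y).

(** From a center to the equation: the three linear relations in (a, b, c) have a nonzero solution,
    so their determinant vanishes. Conversely the coefficients are recovered from the center. The
    conditions on sums say that the diagonal points are not at infinity, those on differences that X
    is on no median; together they make every conic used below nondegenerate. *)
Lemma nine_point_bar u v w : [|| u != 0, v != 0 | w != 0] ->
  nine_point_conic A B C X <[bar u v w]>%VS <->
  x * u * (v + w - u) + y * v * (w + u - v) + z * w * (u + v - w) = 0.
Proof.
move=> n0.
have tA : ((pt A + X) :&: (pt B + pt C))%VS = <[bar 0 (z * x) (x * y)]>%VS.
  by rewrite -(@trace_bar _ _ _ _ nc (y * z)) // mulf_neq0.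
have tB : ((pt B + X) :&: (pt C + pt A))%VS = <[bar (y * z) 0 (x * y)]>%VS.
  by rewrite -(@trace_barB _ _ _ _ nc _ (z * x)) // mulf_neq0.
have tC : ((pt C + X) :&: (pt A + pt B))%VS = <[bar (y * z) (z * x) 0]>%VS.
  by rewrite -(@trace_barC _ _ _ _ nc _ _ (x * y)) // mulf_neq0.
have on_line a b c : <[bar u v w]>%VS = <[bar a b c]>%VS ->
    exists k, [/\ u = k * a, v = k * b & w = k * c].
  move=> e; have : bar u v w \in <[bar a b c]>%VS by rewrite -e memv_line.
  by case/vlineP=> k; rewrite barZ => /(bar_inj nc)[? ? ?]; exists k.
split.
  case=> [[S [[sS uS] hS pS]]|[]]; rewrite ?tA ?tB ?tC.
  - have [p [q [r [a [b [c fS]]]]]] := form_coefficients_exist sS.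
    have nA : [|| 1 != 0 :> R, 0 != 0 :> R | 0 != 0 :> R] by rewrite oner_eq0.
    have nB : [|| 0 != 0 :> R, 1 != 0 :> R | 0 != 0 :> R] by rewrite oner_eq0 orbT.
    have nC : [|| 0 != 0 :> R, 0 != 0 :> R | 1 != 0 :> R] by rewrite oner_eq0 !orbT.
    have p0 : p = 0.
      have : locus S (pt A) by apply: hS; left; left; left.
      by rewrite (ptA_bar A B C) => /(locus_bar fS nA); lra.
    have q0 : q = 0.
      have : locus S (pt B) by apply: hS; left; left; right.
      by rewrite (ptB_bar A B C) => /(locus_bar fS nB); lra.
    have r0 : r = 0.
      have : locus S (pt C) by apply: hS; left; right.
      by rewrite (ptC_bar A B C) => /(locus_bar fS nC); lra.
    move: fS pS; rewrite p0 q0 r0 => fS /(pole_linf_bar fS n0)[e1 e2].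
    have e : a * x + b * y + c * z = 0.
      have : locus S X by apply: hS; right.
      move/(locus_bar fS is_point_X) => e.
      have n2 : (2 : R) != 0 by rewrite pnatr_eq0.
      apply: (mulfI (mulf_neq0 (mulf_neq0 (mulf_neq0 n2 x0) y0) z0)).
      by rewrite mulr0 -[RHS]e; ring.
    have d1 : - w * a + w * b + (v - u) * c = 0 by lra.
    have d2 : (w - v) * a - u * b + u * c = 0 by lra.
    (* The three relations in [(a, b, c)] have determinant [N]. *)
    set N := LHS.
    (* The weights are cofactors of the system, by Cramer's rule. If N were nonzero, b and c would
       vanish, against [form_nonzero]. *)
    have Nb : N * b = 0.
      transitivity ((u * x - (w - v) * z) * (- w * a + w * b + (v - u) * c)
        + (- w * z - (v - u) * x) * ((w - v) * a - u * b + u * c)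
        + (w * u + (v - u) * (w - v)) * (a * x + b * y + c * z)).
        by rewrite /N; ring.
      by rewrite d1 d2 e; ring.
    have Nc : N * c = 0.
      transitivity (((w - v) * y + u * x) * (- w * a + w * b + (v - u) * c)
        + (w * y + w * x) * ((w - v) * a - u * b + u * c)
        + (w * u - w * (w - v)) * (a * x + b * y + c * z)).
        by rewrite /N; ring.
      by rewrite d1 d2 e; ring.
    apply/eqP/negPn/negP => /negPf N0; apply: (form_nonzero fS uS).
    by split=> //; apply/eqP; [move/eqP: Nb|move/eqP: Nc]; rewrite mulf_eq0 N0.
  - by case/on_line=> k [-> -> ->]; ring.
  - by case/on_line=> k [-> -> ->]; ring.
  - by case/on_line=> k [-> -> ->]; ring.
move=> e.
(* On the side u = 0 the equation splits as (w - v)(y v - z w): the first factor gives the midpoint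
   of BC, the second the diagonal point on BC. *)
have [u0|/eqP u0] := eqVneq u 0.
  have : (w - v) * (y * v - z * w) = 0 by rewrite -e u0; ring.
  move/eqP; rewrite mulf_eq0 => /orP[/eqP e1|/eqP e1].
    (* The midpoint of BC is the center when a = b + c; with a x + b y + c z = 0 this leaves these
       coefficients up to a factor. *)
    apply: (@nine_point_center (z - y) (x + z) (- (x + y))) => //; try ring.
    - by move=> h; apply: yz1; lra.
    - by move=> h; apply: zx0; lra.
    - by move=> h; apply: xy0; lra.
    - by rewrite u0; have -> : w = v; [lra | ring].
    - by rewrite u0; have -> : w = v; [lra | ring].
  right; constructor 1; rewrite tA.
  apply: line_bar_eq; last exact: n0.
  - by rewrite !mulf_neq0 ?orbT.
  - transitivity (x * (y * v)); first by ring.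
    by have -> : y * v = z * w; [lra | ring].
  - by rewrite u0; ring.
  - by rewrite u0; ring.
have [v0|/eqP v0] := eqVneq v 0.
  have : (u - w) * (z * w - x * u) = 0 by rewrite -e v0; ring.
  move/eqP; rewrite mulf_eq0 => /orP[/eqP e1|/eqP e1].
    apply: (@nine_point_center (- (y + z)) (x - z) (y + x)) => //; try ring.
    - by move=> h; apply: yz0; lra.
    - by move=> h; apply: zx1; lra.
    - by move=> h; apply: xy0; lra.
    - by rewrite v0; have -> : w = u; [lra | ring].
    - by rewrite v0; have -> : w = u; [lra | ring].
  right; constructor 2; rewrite tB.
  apply: line_bar_eq; last exact: n0.
  - by rewrite !mulf_neq0 ?orbT.
  - by rewrite v0; ring.
  - transitivity (y * (z * w)); first by ring.
    by have -> : z * w = x * u; [lra | ring].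
  - by rewrite v0; ring.
have [w0|/eqP w0] := eqVneq w 0.
  have : (v - u) * (x * u - y * v) = 0 by rewrite -e w0; ring.
  move/eqP; rewrite mulf_eq0 => /orP[/eqP e1|/eqP e1].
    apply: (@nine_point_center (z + y) (- (z + x)) (y - x)) => //; try ring.
    - by move=> h; apply: yz0; lra.
    - by move=> h; apply: zx0; lra.
    - by move=> h; apply: xy1; lra.
    - by rewrite w0; have -> : v = u; [lra | ring].
    - by rewrite w0; have -> : v = u; [lra | ring].
  right; constructor 3; rewrite tC.
  apply: line_bar_eq; last exact: n0.
  - by rewrite !mulf_neq0 ?orbT.
  - by rewrite w0; ring.
  - by rewrite w0; ring.
  - transitivity (z * (x * u)); first by ring.
    by have -> : x * u = y * v; [lra | ring].
have m0 (k t : R) : k <> 0 -> t <> 0 -> k * t <> 0.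
  by move=> /eqP k0 /eqP t0; apply/eqP; rewrite mulf_neq0.
(* For these coefficients the three sums to be compared all equal 2uvw. If v + w - u vanished, the
   equation would reduce to 2vw (y + z) = 0, which is excluded; likewise for the other two. *)
apply: (@nine_point_center (u * (v + w - u)) (v * (w + u - v)) (w * (u + v - w))) => //.
- apply: (m0) => // h.
  apply: (m0 _ _ (m0 _ _ v0 w0) yz0); have eu : u = v + w by lra.
  by move: e; rewrite eu => e; lra.
- apply: (m0) => // h.
  apply: (m0 _ _ (m0 _ _ w0 u0) zx0); have eu : v = w + u by lra.
  by move: e; rewrite eu => e; lra.
- apply: (m0) => // h.
  apply: (m0 _ _ (m0 _ _ u0 v0) xy0); have eu : w = u + v by lra.
  by move: e; rewrite eu => e; lra.
- by rewrite -[RHS]e; ring.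
- ring.
- ring.
Qed.

Lemma nine_point_is_point U : nine_point_conic A B C X U -> is_point U.
Proof.
have nX : [/\ y * z != 0, z * x != 0 & x * y != 0] by rewrite !mulf_neq0.
case: nX => nA nB nC; case=> [[S [_ _ [//]]]|[]->].
- rewrite -[((_ + _) :&: _)%VS]/(trace A B C X) (trace_bar nc) //.
  by apply/(is_point_bar nc); rewrite nB orbT.
- rewrite -[((_ + _) :&: _)%VS]/(trace B C A X) (trace_barB nc) //.
  by apply/(is_point_bar nc); rewrite nA.
- rewrite -[((_ + _) :&: _)%VS]/(trace C A B X) (trace_barC nc) //.
  by apply/(is_point_bar nc); rewrite nA.
Qed.

End NinePoint.
End Forms.

(** * Images of sets of points under invertible maps *)

Section MapSet.
Variables (R : realType) (f : 'End(hvec R)).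
Hypothesis f0 : lker f == 0%VS.

Lemma map_setE S U : map_set f S U <-> S (f^-1 @: U)%VS.
Proof.
split=> [[V SV <-]|SU]; first by rewrite -limg_comp lker0_compVf // lim1g.
by exists (f^-1 @: U)%VS; rewrite // -limg_comp lker0_compfV // lim1g.
Qed.

Lemma map_set_invE S U : map_set (f^-1)%VF S U <-> S (f @: U)%VS.
Proof.
split=> [[V SV <-]|SU]; first by rewrite -limg_comp lker0_compfV // lim1g.
by exists (f @: U)%VS; rewrite // -limg_comp lker0_compVf // lim1g.
Qed.

End MapSet.

(** * The configuration for P = (1 : 1 + s : 1 - s) *)

Section Special.
Variables (R : realType) (A B C : 'rV[R]_2) (s : R).
Hypotheses (nc : noncollinear A B C) (hs : s * s = 2).
Local Notation bar := (barycentric A B C).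
Local Notation eqn := (has_equation A B C).
Let P : flat R := <[bar 1 (1 + s) (1 - s)]>%VS.

(** The norm a^2 - 2b^2 factors as (a + b s)(a - b s); every nonvanishing condition on s below is
    reduced to one on rational numbers. *)
Let nz a b : a * a - 2 * (b * b) <> 0 -> a + b * s <> 0.
Proof.
move=> n0 h; apply: n0; transitivity ((a + b * s) * (a - b * s)).
  by ring: hs.
by rewrite h mul0r.
Qed.

Let nz_s : s <> 0. Proof. by move=> h; apply: (@nz 0 1); lra. Qed.
Let nz_1Ds : 1 + s <> 0. Proof. by move=> h; apply: (@nz 1 1); lra. Qed.
Let nz_1Bs : 1 - s <> 0. Proof. by move=> h; apply: (@nz 1 (-1)); lra. Qed.
Let nz_2Ds : 2 + s <> 0. Proof. by move=> h; apply: (@nz 2 1); lra. Qed.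
Let nz_2Bs : 2 - s <> 0. Proof. by move=> h; apply: (@nz 2 (-1)); lra. Qed.
Let ne_1 : (1 : R) != 0. Proof. exact: oner_neq0. Qed.
Let ne_1Ds : 1 + s != 0. Proof. exact/eqP. Qed.
Let ne_1Bs : 1 - s != 0. Proof. exact/eqP. Qed.

Lemma affine_bar f a b c a' b' c' a'' b'' c'' k k' k'' u v w : affine_map f ->
  (f @: pt A = <[bar a b c]>)%VS -> (f @: pt B = <[bar a' b' c']>)%VS ->
  (f @: pt C = <[bar a'' b'' c'']>)%VS ->
  k * (a + b + c) = 1 -> k' * (a' + b' + c') = 1 -> k'' * (a'' + b'' + c'') = 1 ->
  f (bar u v w) = bar (u * k * a + v * k' * a' + w * k'' * a'')
    (u * k * b + v * k' * b' + w * k'' * b'')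
    (u * k * c + v * k' * c' + w * k'' * c'').
Proof.
move=> af eA eB eC sA sB sC; rewrite lfun_bar (affine_image af eA sA).
by rewrite (affine_image af eB sB) (affine_image af eC sC) !barZ !barD !mulrA.
Qed.

(** The traces D, E, F have total weights 2, 2 - s and 2 + s. Since (2 - s)(2 + s) = 2, their
    inverses are 1/2, (2 + s)/2 and (2 - s)/2. The reflected traces have the same weights. *)
Lemma cevian_map_bar f u v w :
  maps_triangle A B C f (trace A B C P) (trace B C A P) (trace C A B P) ->
  f (bar u v w) = bar (((2 + s) * v + (2 - s) * w) / 2)
    (((1 + s) * u + s * w) / 2) (((1 - s) * u - s * v) / 2).
Proof.
rewrite (trace_bar nc) // (trace_barB nc) // (trace_barC nc) // => -[af eA eB eC].
rewrite (affine_bar (k := 1 / 2) (k' := (2 + s) / 2) (k'' := (2 - s) / 2)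
  _ _ _ af eA eB eC).
- by congr barycentric; field: hs.
- by field.
- by field: hs.
- by field: hs.
Qed.

Lemma refl_cevian_map_bar f u v w :
  maps_triangle A B C f (refl_trace A B C P) (refl_trace B C A P)
    (refl_trace C A B P) ->
  f (bar u v w) = bar (s * (w - v) / 2)
    (((1 - s) * u + (2 - s) * w) / 2) (((1 + s) * u + (2 + s) * v) / 2).
Proof.
rewrite (refl_trace_bar nc) // (refl_trace_barB nc) // (refl_trace_barC nc) //.
move=> [af eA eB eC].
rewrite (affine_bar (k := 1 / 2) (k' := (2 + s) / 2) (k'' := (2 - s) / 2)
  _ _ _ af eA eB eC).
- by congr barycentric; field: hs.
- by field.
- by field: hs.
- by field: hs.
Qed.

Lemma isotomic_special : isotomic A B C P = <[bar (-1) (1 - s) (1 + s)]>%VS.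
Proof.
rewrite isotomic_bar //; congr (<[barycentric _ _ _ _ _ _]>%VS); ring: hs.
Qed.

Lemma circumconic_bar TP' u v w :
  maps_triangle A B C TP' (refl_trace A B C P) (refl_trace B C A P)
    (refl_trace C A B P) ->
  [|| u != 0, v != 0 | w != 0] ->
  map_set (TP'^-1)%VF (nine_point_conic A B C (isotomic A B C P)) <[bar u v w]>%VS
  <-> 2 * (v * w) + w * u + u * v = 0.
Proof.
move=> mT n0; have := mT => -[[k0 _] _ _ _]; move/eqP in k0.
rewrite (map_set_invE k0) limg_line isotomic_bar //.
have := refl_cevian_map_bar u v w mT => eT; rewrite eT.
rewrite (nine_point_bar nc) //; first last.
- rewrite -!negb_and -(bar_eq0 nc) -eT -(linear0 TP').
  by rewrite (inj_eq (lker0P k0)) (bar_eq0 nc) !negb_and.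
- by move=> h; apply: nz_s; lra.
- by move=> h; apply: nz_s; lra.
- by move=> h; apply: nz_s; lra.
- by move=> h; apply: nz_2Ds; lra.
- by move=> h; apply: nz_2Bs; lra.
- by lra.
set N := LHS; suff -> : N = 2 * (v * w) + w * u + u * v by [].
by rewrite /N; field: hs.
Qed.

Lemma circumconic_is_point TP' U :
  maps_triangle A B C TP' (refl_trace A B C P) (refl_trace B C A P)
    (refl_trace C A B P) ->
  map_set (TP'^-1)%VF (nine_point_conic A B C (isotomic A B C P)) U ->
  is_point U.
Proof.
move=> [[k0 _] _ _ _]; move/eqP in k0; rewrite (map_set_invE k0) isotomic_bar //.
move/(nine_point_is_point nc) => /(_ ne_1 ne_1Ds ne_1Bs).
by rewrite /is_point limg_dim_eq // (eqP k0) capv0.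
Qed.

(** The added vector is Q - O, with Q = (1, s/2, -s/2) and O = (0, 1/2, 1/2) in normalized
    coordinates. *)
Lemma translation_bar TP TP' u v w :
  maps_triangle A B C TP (trace A B C P) (trace B C A P) (trace C A B P) ->
  maps_triangle A B C TP' (refl_trace A B C P) (refl_trace B C A P)
    (refl_trace C A B P) ->
  (TP \o (complement_map A B C)^-1 \o TP')%VF (bar u v w) =
  bar (u + (u + v + w)) (v + (s - 1) / 2 * (u + v + w))
    (w - (s + 1) / 2 * (u + v + w)).
Proof.
move=> mT mT'; rewrite !comp_lfunE (refl_cevian_map_bar _ _ _ mT').
rewrite complement_inv_bar // (cevian_map_bar _ _ _ mT).
by congr barycentric; field: hs.
Qed.

Lemma translation_from_bar (f : 'End(hvec R)) a b c : a + b + c = 0 ->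
  (forall u v w, f (bar u v w) =
     bar (u + a * (u + v + w)) (v + b * (u + v + w)) (w + c * (u + v + w))) ->
  translation f.
Proof.
move=> s0 fE; exists (a *: A + b *: B + c *: C) => p.
have [x [y [z e]]] := bar_surj nc (hom p); have s1 := bar_sum e.
rewrite e fE s1 !mulr1 -barD -e [bar a b c]bar_row s0 /hom add_row_mx.
by congr row_mx; apply/rowP=> i; rewrite !mxE !ord1 eqxx; ring.
Qed.

Lemma inconic_special f :
  lker f == 0%VS ->
  (forall u v w, f (bar u v w) =
  bar (u + (u + v + w)) (v + (s - 1) / 2 * (u + v + w))
    (w - (s + 1) / 2 * (u + v + w))) ->
  forall C_O : set (flat R), C_O `<=` @is_point R ->
  (forall u v w, [|| u != 0, v != 0 | w != 0] ->
    C_O <[bar u v w]>%VS <-> 2 * (v * w) + w * u + u * v = 0) ->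
  is_inconic A B C P (map_set f C_O).
Proof.
move=> k0 fE C_O pC eC.
(* The inconic with perspector (x : y : z) is (u/x)^2 + (v/y)^2 + (w/z)^2 - 2 (vw/(yz) + wu/(zx) +
   uv/(xy)) = 0; here 1/(1 + s) = s - 1 and 1/(1 - s) = -(1 + s). Composed with f, this form is -2
   times that of [C_O]. *)
have [S [sS fS]] := symmetric_form nc 1 ((1 - s) * (1 - s)) ((1 + s) * (1 + s))
  1 (1 + s) (1 - s).
have locE u v w : [|| u != 0, v != 0 | w != 0] -> locus S <[bar u v w]>%VS <->
    1 * (u * u) + (1 - s) * (1 - s) * (v * v) + (1 + s) * (1 + s) * (w * w)
    + 2 * 1 * (v * w) + 2 * (1 + s) * (w * u) + 2 * (1 - s) * (u * v) = 0.
  exact: (locus_bar nc fS).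
have CS : map_set f C_O = locus S.
  apply/seteqP; split=> U.
    case=> V CV <-; have [u [v [w [eV n0]]]] := is_pointP nc (pC _ CV).
    rewrite eV limg_line fE; apply/locE.
      by rewrite -!negb_and -(bar_eq0 nc) -fE -(linear0 f)
        (inj_eq (lker0P k0)) (bar_eq0 nc) !negb_and.
    move: CV; rewrite eV => /(eC _ _ _ n0) e.
    transitivity ((- 2) * (2 * (v * w) + w * u + u * v)); last by rewrite e mulr0.
    by field: hs.
  move=> SU; have pV : is_point (f^-1 @: U)%VS.
    have [pU _] := SU.
    rewrite /is_point -(@limg_dim_eq _ _ _ f) ?(eqP k0) ?capv0 //.
    by rewrite -limg_comp lker0_compfV // lim1g.
  have [u [v [w [eV n0]]]] := is_pointP nc pV.
  have eU : U = <[f (bar u v w)]>%VS.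
    by rewrite -limg_line -eV -limg_comp lker0_compfV // lim1g.
  apply/(map_setE k0); rewrite eV; apply/(eC _ _ _ n0).
  move: SU; rewrite eU fE => /locE e.
  have {}e : - 2 * (2 * (v * w) + w * u + u * v) = 0.
    rewrite -[RHS]e; first by field: hs.
    by rewrite -!negb_and -(bar_eq0 nc) -fE -(linear0 f)
      (inj_eq (lker0P k0)) (bar_eq0 nc) !negb_and.
  lra.
have tangent (x y z : R) L : [|| x != 0, y != 0 | z != 0] ->
    (forall U, points_of L U -> locus S U -> U = <[bar x y z]>%VS) ->
    (bar x y z \in L) ->
    1 * (x * x) + (1 - s) * (1 - s) * (y * y) + (1 + s) * (1 + s) * (z * z)
    + 2 * 1 * (y * z) + 2 * (1 + s) * (z * x) + 2 * (1 - s) * (x * y) = 0 ->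
    tangent_at (locus S) L <[bar x y z]>%VS.
  move=> n0 uniq inL e; apply/seteqP; split=> [U [SU LU]|U ->].
    exact: uniq.
  split; first by apply/locE.
  by split; [apply/(is_point_bar nc)|rewrite -memvE].
have sq (r : R) : r * r = 0 -> r = 0 by move/eqP; rewrite mulf_eq0 orbb => /eqP.
rewrite CS; split.
- exists S => //; split=> //; apply: (form_unitmx nc fS) => u v w h1 h2 h3.
  have w0 : w = 0.
    have : (1 - s) * (1 * u + (1 - s) * v + (1 + s) * w)
      - ((1 - s) * u + (1 - s) * (1 - s) * v + 1 * w) = 0.
      by rewrite h1 h2; ring.
    have -> : (1 - s) * (1 * u + (1 - s) * v + (1 + s) * w)
      - ((1 - s) * u + (1 - s) * (1 - s) * v + 1 * w) = - 2 * w by ring: hs.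
    lra.
  have v0 : v = 0.
    have : (1 + s) * (1 * u + (1 - s) * v + (1 + s) * w)
      - ((1 + s) * u + 1 * v + (1 + s) * (1 + s) * w) = 0.
      by rewrite h1 h3; ring.
    have -> : (1 + s) * (1 * u + (1 - s) * v + (1 + s) * w)
      - ((1 + s) * u + 1 * v + (1 + s) * (1 + s) * w) = - 2 * v by ring: hs.
    lra.
  by split=> //; move: h1; rewrite v0 w0; lra.
- rewrite (trace_bar nc) //; apply: tangent.
  + by rewrite ne_1Ds orbT.
  + move=> U [pU LU] SU; have [u [v [w [eU n0]]]] := is_pointP nc pU.
    move: LU SU; rewrite eU -memvE => /(side_equation nc) eL /(locE _ _ _ n0) e.
    have u0 : u = 0 by lra.
    (* Tangency: restricted to a side the form is the square of a linear form, whose only zero there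
       is the trace of P. *)
    have : (1 - s) * v - (1 + s) * w = 0.
      by apply: sq; rewrite -[RHS]e u0; ring: hs.
    move=> e'; apply: line_bar_eq n0 => //; first by rewrite ne_1Ds orbT.
    * by lra.
    * by rewrite u0; ring.
    * by rewrite u0; ring.
  + by apply/(side_equation nc); ring.
  + by ring: hs.
- rewrite (trace_barB nc) //; apply: tangent.
  + by rewrite ne_1.
  + move=> U [pU LU] SU; have [u [v [w [eU n0]]]] := is_pointP nc pU.
    move: LU SU; rewrite eU -memvE => /(side_equationB nc) eL /(locE _ _ _ n0) e.
    have v0 : v = 0 by lra.
    have e' : u + (1 + s) * w = 0.
      by apply: sq; rewrite -[RHS]e v0; ring: hs.
    have eu : u = - (1 + s) * w by lra.
    apply: line_bar_eq n0 => //; first by rewrite ne_1.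
    * by rewrite v0; ring.
    * by rewrite eu; ring: hs.
    * by rewrite v0; ring.
  + by apply/(side_equationB nc); ring.
  + by ring: hs.
- rewrite (trace_barC nc) //; apply: tangent.
  + by rewrite ne_1.
  + move=> U [pU LU] SU; have [u [v [w [eU n0]]]] := is_pointP nc pU.
    move: LU SU; rewrite eU -memvE => /(side_equationC nc) eL /(locE _ _ _ n0) e.
    have w0 : w = 0 by lra.
    have e' : u + (1 - s) * v = 0.
      by apply: sq; rewrite -[RHS]e w0; ring: hs.
    have eu : u = - (1 - s) * v by lra.
    apply: line_bar_eq n0 => //; first by rewrite ne_1.
    * by rewrite w0; ring.
    * by rewrite w0; ring.
    * by rewrite eu; ring: hs.
  + by apply/(side_equationC nc); ring.
  + by ring: hs.
Qed.

Lemma gen_circumcenter_special :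
  gen_circumcenter A B C <[bar (-1) (1 - s) (1 + s)]>%VS =
  <[bar (- 4) (5 - 4 * s) (5 + 4 * s)]>%VS.
Proof.
have m1 : (-1 : R) != 0 by rewrite oppr_eq0 oner_eq0.
have mid p q : pt (midpoint p q) = <[hom p + hom q]>%VS :> flat R.
  rewrite /pt hom_midpoint; apply/eqP; rewrite eqEsubv -!memvE.
  rewrite memvZ ?memv_line //; apply/vlineP; exists 2.
  by rewrite scalerA divff ?scale1r // pnatr_eq0.
rewrite /gen_circumcenter isotomcomplement_bar // (trace_bar nc) //.
rewrite (trace_barB nc) // (trace_barC nc) // !mid.
rewrite (hom_barA A B C) (hom_barB A B C) (hom_barC A B C) !barD.
(* This point is Q' = K(P), of coordinates (y + z : z + x : x + y) up to sign. The next three facts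
   give the points at infinity of Q'D_3, Q'E_3 and Q'F_3. *)
have -> : <[bar (-1 * (1 - s + (1 + s))) ((1 - s) * (1 + s + -1))
    ((1 + s) * (-1 + (1 - s)))]>%VS = <[bar (-2) (s - 2) (- s - 2)]>%VS.
  by congr (<[barycentric _ _ _ _ _ _]>%VS); ring: hs.
have iA : ((<[bar (-2) (s - 2) (- s - 2)]> + <[bar 0 (1 - s) (1 + s)]>) :&: linf R
    = <[bar 2 (2 * s - 1) (- 2 * s - 1)]>)%VS.
  apply: (@meet_equationsW _ _ _ _ nc _ _ _ _ _ (- s) (1 + s) (s - 1) 1 1 1).
  - by apply: neq0_or3; constructor 1; lra.
  - by apply: neq0_or3; constructor 1; lra.
  - apply: (join_equationW nc); try ring: hs.
    + by apply: neq0_or3; constructor 2 => h; apply: nz_1Ds; lra.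
    + by apply: neq0_or3; constructor 1 => h; apply: nz_s; lra.
  - exact: linf_equation.
  - by ring: hs.
  - by ring.
have iB : ((<[bar (-2) (s - 2) (- s - 2)]> + <[bar (-1) 0 (1 + s)]>) :&: linf R
    = <[bar (- 3 * s - 2) (s - 2) (2 * s + 4)]>)%VS.
  apply: (@meet_equationsW _ _ _ _ nc _ _ _ _ _ (- s) (3 * s + 4) (s - 2) 1 1 1).
  - by apply: neq0_or3; constructor 2 => h; apply: nz_1Bs; lra.
  - by apply: neq0_or3; constructor 2 => h; apply: nz_2Bs; lra.
  - apply: (join_equationW nc); try ring: hs.
    + by apply: neq0_or3; constructor 3 => h; apply: nz_2Bs; lra.
    + by apply: neq0_or3; constructor 1 => h; apply: nz_s; lra.
  - exact: linf_equation.
  - by ring: hs.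
  - by ring.
have iC : ((<[bar (-2) (s - 2) (- s - 2)]> + <[bar (-1) (1 - s) 0]>) :&: linf R
    = <[bar (3 * s - 2) (4 - 2 * s) (- 2 - s)]>)%VS.
  apply: (@meet_equationsW _ _ _ _ nc _ _ _ _ _ (- s) (s + 2) (3 * s - 4) 1 1 1).
  - by apply: neq0_or3; constructor 2 => h; apply: nz_1Bs; lra.
  - by apply: neq0_or3; constructor 2 => h; apply: nz_2Bs; lra.
  - apply: (join_equationW nc); try ring: hs.
    + apply: neq0_or3; constructor 2 => h; apply: nz_2Ds; lra.
    + by apply: neq0_or3; constructor 1 => h; apply: nz_s; lra.
  - exact: linf_equation.
  - by ring: hs.
  - by ring.
rewrite /parallel_through iA iB iC.
have eA : eqn (<[bar (0 + 0) (1 + 0) (0 + 1)]>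
    + <[bar 2 (2 * s - 1) (- 2 * s - 1)]>)%VS
    (- 2 * s) 1 (-1).
  apply: (join_equationW nc); try ring.
  + by apply: neq0_or3; constructor 2; lra.
  + by apply: neq0_or3; constructor 2; lra.
have eB : eqn (<[bar (0 + 1) (0 + 0) (1 + 0)]>
    + <[bar (- 3 * s - 2) (s - 2) (2 * s + 4)]>)%VS
    (2 - s) (- 5 * s - 6) (s - 2).
  apply: (join_equationW nc); try ring.
  + by apply: neq0_or3; constructor 1 => h; apply: nz_2Bs; lra.
  + by apply: neq0_or3; constructor 1 => h; apply: nz_2Bs; lra.
have eC : eqn (<[bar (1 + 0) (0 + 1) (0 + 0)]>
    + <[bar (3 * s - 2) (4 - 2 * s) (- 2 - s)]>)%VS
    (- 2 - s) (2 + s) (6 - 5 * s).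
  apply: (join_equationW nc); try ring.
  + by apply: neq0_or3; constructor 1 => h; apply: nz_2Ds; lra.
  + by apply: neq0_or3; constructor 1 => h; apply: nz_2Ds; lra.
rewrite (meet_equationsW nc (u := - 4) (v := 5 - 4 * s) (w := 5 + 4 * s) _ _ eA eB).
- by apply/capv_idPl; rewrite -memvE; apply/eC; ring: hs.
- have -> : 1 * (s - 2) - -1 * (- 5 * s - 6) = - 8 + -4 * s by ring.
  apply: neq0_or3; constructor 1; apply: nz; lra.
- by apply: neq0_or3; constructor 1; lra.
- by ring.
- by ring: hs.
Qed.

Lemma isotomcomplement_special :
  isotomcomplement A B C P = <[bar 2 s (- s)]>%VS.
Proof.
rewrite isotomcomplement_bar //.
by congr (<[barycentric _ _ _ _ _ _]>%VS); ring: hs.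
Qed.

Let Kinv := ((complement_map A B C)^-1)%VF.
Let l : flat R := (Kinv @: (pt A + isotomcomplement A B C P))%VS.

(** The first point is K^{-1}(A), also the reflection of A in the midpoint of BC; the second is P',
    because Q = K(P'). *)
Let lE : l = (<[bar (-1) 1 1]> + <[bar (-2) (2 - 2 * s) (2 + 2 * s)]>)%VS.
Proof.
rewrite /l isotomcomplement_special (ptA_bar A B C) limgD !limg_line.
rewrite !complement_inv_bar //.
by congr (<[barycentric _ _ _ _ _ _]> + <[barycentric _ _ _ _ _ _]>)%VS; ring.
Qed.

Lemma line_special_is_line : is_line l.
Proof.
by rewrite lE; apply: (is_line_join nc); apply: neq0_or3; constructor 1 => h;
  apply: nz_s; lra.
Qed.

Lemma line_special_equation : eqn l 2 1 1.
Proof.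
rewrite lE; apply: (join_equationW nc); try ring.
  by apply: neq0_or3; constructor 1 => h; apply: nz_s; lra.
by apply: neq0_or3; constructor 2; lra.
Qed.

Lemma line_special_K2 : l = (Kinv @: (Kinv @: (pt B + pt C)))%VS.
Proof.
apply: (equation_inj nc line_special_equation).
rewrite (ptB_bar A B C) (ptC_bar A B C) !limgD !limg_line !complement_inv_bar //.
apply: (join_equationW nc); try ring.
  by apply: neq0_or3; constructor 2; lra.
by apply: neq0_or3; constructor 2; lra.
Qed.

Let BC_infinity : ((pt B + pt C) :&: linf R = <[bar 0 1 (-1)]>)%VS.
Proof.
apply: (meet_equationsW nc _ _ (side_equation nc) (linf_equation A B C)); try ring.
  by apply: neq0_or3; constructor 2; lra.
by apply: neq0_or3; constructor 2; lra.
Qed.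

Lemma line_special_parallel : parallel l (pt B + pt C)%VS.
Proof.
rewrite /parallel BC_infinity.
apply: (meet_equationsW nc _ _ line_special_equation (linf_equation A B C)); try ring.
  by apply: neq0_or3; constructor 2; lra.
by apply: neq0_or3; constructor 2; lra.
Qed.

Lemma reflection_on_line : (reflection (midpoint B C) @: pt A <= l)%VS.
Proof.
rewrite (ptA_bar A B C) limg_line reflection_bar -memvE.
by apply/line_special_equation; ring.
Qed.

Lemma isotomic_line_special u v w : [|| u != 0, v != 0 | w != 0] ->
  isotomic_line A B C l <[bar u v w]>%VS <-> 2 * (v * w) + w * u + u * v = 0.
Proof.
move=> n0; split.
  case=> _ [a [b [c [x [y [z [el eU e]]]]]]].
  have : bar u v w \in <[bar x y z]>%VS by rewrite -eU memv_line.
  case/vlineP=> k; rewrite barZ => /(bar_inj nc)[-> -> ->].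
  (* An arbitrary equation of l is compared with (2, 1, 1) on the points (0 : 1 : -1) and (1 : -2 :
     0) of l; A, which is not on l, shows that it is not the zero equation. *)
  have e1 : a * 0 + b * 1 + c * (-1) = 0.
    by apply/el/line_special_equation; ring.
  have e2 : a * 1 + b * (-2) + c * 0 = 0.
    by apply/el/line_special_equation; ring.
  have b0 : b != 0.
    apply/eqP => b0; have : bar 1 0 0 \in l by apply/el; lra.
    by move/line_special_equation; lra.
  apply: (mulfI b0); rewrite mulr0.
  transitivity (k * k * (a * (y * z) + b * (z * x) + c * (x * y))).
    have -> : a = 2 * b by lra.
    by have -> : c = b; [lra | ring].
  by rewrite e mulr0.
move=> e; split; first exact/(is_point_bar nc).
exists 2, 1, 1, u, v, w; split=> //; first exact: line_special_equation.
by lra.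
Qed.

Lemma centroid_parallel_equation :
  eqn (parallel_through (pt (centroid A B C)) (pt B + pt C)%VS) 2 (-1) (-1).
Proof.
rewrite /parallel_through BC_infinity.
have -> : pt (centroid A B C) = <[bar 3^-1 3^-1 3^-1]>%VS.
  rewrite /pt (@hom_bar _ A B C 3^-1 3^-1 3^-1) //; first by field.
  by rewrite /centroid !scalerDr.
apply: (join_equationW nc); try ring.
  by apply: neq0_or3; constructor 2; lra.
by apply: neq0_or3; constructor 1; lra.
Qed.

(** On the line v + w = 2u the conic becomes vw = -u^2, exactly the two relations that determined P.
    The other solution exchanges the last two coordinates, that is s and -s. *)
Lemma centroid_parallel_meet (C_O : set (flat R)) : C_O `<=` @is_point R ->
  (forall u v w, [|| u != 0, v != 0 | w != 0] ->
    C_O <[bar u v w]>%VS <-> 2 * (v * w) + w * u + u * v = 0) ->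
  exists P2, P2 <> P /\
    points_of (parallel_through (pt (centroid A B C)) (pt B + pt C)%VS) `&` C_O
    = [set P; P2].
Proof.
move=> pC eC; exists <[bar 1 (1 - s) (1 + s)]>%VS; split.
  move=> e; have : bar 1 (1 - s) (1 + s) \in P by rewrite -e memv_line.
  case/vlineP=> k; rewrite barZ => /(bar_inj nc)[e1 e2 _].
  have k1 : k = 1 by lra.
  by apply: nz_s; move: e2; rewrite k1; lra.
have n1 y z : [|| 1 != 0 :> R, y != 0 :> R | z != 0 :> R] by rewrite ne_1.
apply/seteqP; split=> U.
  case=> -[pU LU] CU; have [u [v [w [eU n0]]]] := is_pointP nc pU.
  move: LU CU; rewrite eU -memvE => /centroid_parallel_equation e /(eC _ _ _ n0) e'.
  have ew : w = 2 * u - v by lra.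
  have : (v - (1 + s) * u) * (v - (1 - s) * u) = 0.
    have -> : (v - (1 + s) * u) * (v - (1 - s) * u) =
        v * v - 2 * (u * v) - u * u by ring: hs.
    by move: e'; rewrite ew; lra.
  move/eqP; rewrite mulf_eq0 => /orP[] /eqP ev; [left|right].
    have {}ev : v = (1 + s) * u by lra.
    by apply: line_bar_eq n0; rewrite ?n1 // ?ew ?ev; ring: hs.
  have {}ev : v = (1 - s) * u by lra.
  by apply: line_bar_eq n0; rewrite ?n1 // ?ew ?ev; ring: hs.
have mem y z : y + z = 2 -> y * z = -1 ->
    (points_of (parallel_through (pt (centroid A B C)) (pt B + pt C)%VS) `&` C_O)
    <[bar 1 y z]>%VS.
  move=> e1 e2; split.
    split; first by apply/(is_point_bar nc); rewrite ne_1.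
    by rewrite -memvE; apply/centroid_parallel_equation; lra.
  by apply/eC => //; rewrite e2; lra.
by case=> ->; apply: mem; ring: hs.
Qed.

(** The common line -2s u + v - w = 0 is also the parallel to Q'D_3 through the midpoint of BC,
    which by definition contains O'. *)
Lemma special_collinear : collinear [set <[bar 0 1 1]>%VS;
  <[bar (- 4) (5 - 4 * s) (5 + 4 * s)]>%VS; P; <[bar (-1) (1 - s) (1 + s)]>%VS].
Proof.
have n0 : [|| 1 * (1 - s) - 1 * (1 + s) != 0, 1 * 1 - 0 * (1 - s) != 0
    | 0 * (1 + s) - 1 * 1 != 0].
  by apply: neq0_or3; constructor 2; lra.
exists (<[bar 0 1 1]> + <[bar 1 (1 + s) (1 - s)]>)%VS.
  exact: (is_line_join nc).
have e : eqn (<[bar 0 1 1]> + <[bar 1 (1 + s) (1 - s)]>)%VS (- 2 * s) 1 (-1).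
  by apply: (join_equationW nc); try ring; apply: neq0_or3; constructor 2; lra.
have mem x y z : [|| x != 0, y != 0 | z != 0] -> - 2 * s * x + 1 * y + -1 * z = 0 ->
    points_of (<[bar 0 1 1]> + <[bar 1 (1 + s) (1 - s)]>)%VS <[bar x y z]>%VS.
  by move=> h1 h2; split; [exact/(is_point_bar nc)|rewrite -memvE; apply/e].
move=> U [[[->|->]|->]|->]; apply: mem; try ring.
- by rewrite ne_1 !orbT.
- by apply: neq0_or3; constructor 1 => h; apply: nz_s; lra.
- by rewrite ne_1.
- by rewrite oppr_eq0 ne_1.
Qed.

Lemma special_distance : exists p p' : 'rV[R]_2,
  [/\ P = pt p, <[bar (-1) (1 - s) (1 + s)]>%VS = pt p'
    & dist (midpoint B C) p' = 3 * dist (midpoint B C) p].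
Proof.
exists (3^-1 *: (A + (1 + s) *: B + (1 - s) *: C)).
exists (- A + (1 - s) *: B + (1 + s) *: C); split.
- rewrite /P -(@line_barZ _ _ _ _ 3^-1) ?invr_eq0 ?pnatr_eq0 // /pt.
  congr (<[_]>%VS); apply/esym/hom_bar; first by field.
  by apply/rowP=> i; rewrite !mxE; ring.
- rewrite /pt; congr (<[_]>%VS); apply/esym/hom_bar; first by ring.
  by rewrite scaleN1r.
rewrite /dist; set p := 3^-1 *: _; set p' := - A + _ + _.
(* Coordinatewise D_0 - p' = -3 (D_0 - p): the two points lie on opposite sides of D_0. *)
have -> : \sum_(i < 2) (midpoint B C 0 i - p' 0 i) ^+ 2 =
    3 ^+ 2 * \sum_(i < 2) (midpoint B C 0 i - p 0 i) ^+ 2.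
  rewrite mulr_sumr; apply: eq_bigr => i _.
  by rewrite /p /p' /midpoint !mxE; field.
by rewrite sqrtrM ?exprn_ge0 // sqrtr_sqr ger0_norm.
Qed.

End Special.

Theorem proposition4p4 (R : realType) (A B C : 'rV[R]_2) (P : flat R)
    (TP TP' : 'End(hvec R)) :
  noncollinear A B C ->
  is_point P ->
  not_on_sides A B C P ->
  not_on_anticomplementary_sides A B C P ->
  let G := centroid A B C in
  let D0 := midpoint B C in
  let Kinv := ((complement_map A B C)^-1)%VF in
  let BC := (pt B + pt C)%VS in
  let D3 := refl_trace A B C P in
  let P' := isotomic A B C P in
  let Q := isotomcomplement A B C P in
  let O := gen_circumcenter A B C P in
  let O' := gen_circumcenter A B C P' in
  let H := gen_orthocenter A B C P in
  maps_triangle A B C TP (trace A B C P) (trace B C A P) (trace C A B P) ->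
  maps_triangle A B C TP' (refl_trace A B C P) (refl_trace B C A P)
    (refl_trace C A B P) ->
  let C_O := map_set (TP'^-1)%VF (nine_point_conic A B C P') in
  let M := (TP \o Kinv \o TP')%VF in
  let l := (Kinv @: (pt A + Q))%VS in
  let l_G := parallel_through (pt G) BC in
  H = pt A ->
  O = pt D0 ->
  (exists2 p' : 'rV[R]_2, P' = pt p' & D3 = pt (midpoint A p')) ->
  [/\ exists o p p' : 'rV[R]_2,
        [/\ O = pt o, P = pt p, P' = pt p',
            dist o p' = 3 * dist o p
          & [/\ is_line l, (reflection o @: pt A <= l)%VS & parallel l BC]],
      l = (Kinv @: (Kinv @: BC))%VS /\ C_O = isotomic_line A B C l,
      collinear [set O; O'; P; P'],
      translation M /\ is_inconic A B C P (map_set M C_O)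
    & exists P2 : flat R, P2 <> P /\ points_of l_G `&` C_O = [set P; P2]].
Proof.
move=> nc pP sides asides G D0 Kinv BC D3 P' Q O O' H mT mT' C_O M l l_G eH eO eP'.
have [s hs eP] := special_point nc pP sides asides eH eP'.
(* The local definitions depend on [P]; they are generalized so that [P] can be replaced by its
   coordinates. *)
move: @D3 @P' @Q @O @O' @H mT mT' @C_O @l eH eO eP'; rewrite {}eP {pP sides asides P}.
move=> D3 P' Q O O' H mT mT' C_O l _ eO _.
have eP' : P' = <[barycentric A B C (-1) (1 - s) (1 + s)]>%VS.
  exact: isotomic_special.
have pC : C_O `<=` @is_point R.
  by move=> U; apply: (circumconic_is_point nc hs mT').
have eC u v w : [|| u != 0, v != 0 | w != 0] ->
    C_O <[barycentric A B C u v w]>%VS <-> 2 * (v * w) + w * u + u * v = 0.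
  exact: (circumconic_bar nc hs mT').
have fM u v w := translation_bar nc hs u v w mT mT'.
have kM : lker M == 0%VS.
  apply/lker0P => t t'; rewrite !comp_lfunE.
  have [[kT _] _ _ _] := mT; have [[kT' _] _ _ _] := mT'.
  move/eqP/lker0P in kT; move/eqP/lker0P in kT'.
  by move/kT/(can_inj (lker0_lfunVK (lker_complement nc)))/kT'.
split.
- have [p [p' [ep ep' d]]] := special_distance A B C s.
  exists D0, p, p'; split=> //; first by rewrite eP'.
  split; [exact: line_special_is_line|exact: reflection_on_line|].
  exact: line_special_parallel.
- split; first exact: line_special_K2.
  apply/seteqP; split=> U.
    move=> CU; have [u [v [w [eU n0]]]] := is_pointP nc (pC _ CU).
    by move: CU; rewrite eU => /(eC _ _ _ n0)/(isotomic_line_special nc hs n0).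
  move=> CU; have pU : is_point U by case: CU.
  have [u [v [w [eU n0]]]] := is_pointP nc pU.
  by move: CU; rewrite eU => /(isotomic_line_special nc hs n0)/(eC _ _ _ n0).
- rewrite eO /O' eP' (gen_circumcenter_special nc hs).
  have -> : pt D0 = <[barycentric A B C 0 1 1]>%VS.
    rewrite /pt hom_midpoint (hom_barB A B C) (hom_barC A B C) barD !barZ.
    by rewrite line_barZ ?invr_eq0 ?pnatr_eq0 // !addr0 !add0r.
  exact: special_collinear.
- split; last exact: inconic_special kM fM _ pC eC.
  apply: (translation_from_bar nc (a := 1) (b := (s - 1) / 2) (c := - ((s + 1) / 2))).
    by field.
  by move=> u v w; rewrite fM mul1r mulNr.
exact: centroid_parallel_meet pC eC.
Qed.
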